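(* Let $s_1, s_2 \in \{0,\tfrac12,1,\tfrac32,\dots\}$, and let $V_{s_1}, V_{s_2}$ be the $SU(2)$-linear spaces associated to the spin $s_1$ and spin $s_2$ representations, respectively. Then, as representations of $SU(2)$, $$V_{s_{1}} \otimes V_{s_{2}} \cong \bigoplus_{s = |s_{1}-s_{2}|}^{s_{1}+s_{2}} V_{s},$$ where $s$ runs in integer steps over $|s_1-s_2|, |s_1-s_2|+1, \dots, s_1+s_2$, and $V_s$ is the $SU(2)$-linear space associated to the spin $s$ representation.
   Context: For $s\in\{0,\tfrac12,1,\tfrac32,\dots\}$, the spin $s$ representation $V_s$ is the irreducible finite-dimensional complex (continuous) representation of $SU(2)$ of dimension $2s+1$, which is unique up to isomorphism. ''$SU(2)$-linear space'' means a complex vector space carrying a representation of $SU(2)$. $SU(2)$ acts on $V_{s_1}\otimes V_{s_2}$ by $g\cdot(v\otimes w) = gv\otimes gw$. *)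

(* Defs.v *)
From HB Require Import structures.
From mathcomp Require Import all_boot all_order all_algebra.
From mathcomp Require Import mxtens complex.
From mathcomp Require Import all_classical all_reals all_analysis.

Set Implicit Arguments.
Unset Strict Implicit.
Unset Printing Implicit Defensive.

Import Order.TTheory GRing.Theory Num.Theory.
Import numFieldNormedType.Exports.

Local Open Scope classical_set_scope.
Local Open Scope ring_scope.

(* The cast makes the topology of numerical fields available on R[i]. *)
Definition Cplx (R : realType) : numClosedFieldType := (R[i])%C.

Definition SU2 (R : realType) : set 'M[Cplx R]_2 :=
  [set g | g \is unitarymx /\ \det g = 1].

(* A representation of SU(2) on the column space C^d, g acting by
   v |-> rho g *m v; the values of rho outside SU(2) are irrelevant. *)
Record su2_rep (R : realType) (d : nat) := Su2Rep {
  rep_fun :> 'M[Cplx R]_2 -> 'M[Cplx R]_d ;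
  rep_one : rep_fun 1%:M = 1%:M ;
  rep_mul : forall g h, SU2 g -> SU2 h ->
    rep_fun (g *m h) = rep_fun g *m rep_fun h }.

Definition rep_continuous (R : realType) (d : nat) (rho : su2_rep R d) : Prop :=
  {within @SU2 R, continuous rho}.

Definition rep_irreducible (R : realType) (d : nat) (rho : su2_rep R d) : Prop :=
  (0 < d)%N /\
  forall U : {vspace 'cV[Cplx R]_d},
    (forall g v, SU2 g -> v \in U -> rho g *m v \in U) ->
    U = 0%VS \/ U = fullv.

Definition rep_iso (R : realType) (d d' : nat)
    (rho : su2_rep R d) (sigma : su2_rep R d') : Prop :=
  exists (T : 'M[Cplx R]_(d', d)) (S : 'M[Cplx R]_(d, d')),
    [/\ T *m S = 1%:M, S *m T = 1%:M &
        forall g, SU2 g -> T *m rho g = sigma g *m T].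

Section Constructions.
Variable R : realType.

Fact tens_rep_one (d1 d2 : nat) (rho1 : su2_rep R d1) (rho2 : su2_rep R d2) :
  rho1 1%:M *t rho2 1%:M = 1%:M.
Proof.
rewrite !rep_one; apply/matrixP=> i j.
case: (mxtens_indexP i) => i1 i2; case: (mxtens_indexP j) => j1 j2.
rewrite tensmxE !mxE -natrM mulnb; congr ((nat_of_bool _)%:R).
by rewrite (can_eq (@mxtens_indexK d1 d2)).
Qed.

Fact tens_rep_mul (d1 d2 : nat) (rho1 : su2_rep R d1) (rho2 : su2_rep R d2)
    (g h : 'M[Cplx R]_2) : SU2 g -> SU2 h ->
  rho1 (g *m h) *t rho2 (g *m h) = (rho1 g *t rho2 g) *m (rho1 h *t rho2 h).
Proof. by move=> gS hS; rewrite tensmx_mul !rep_mul. Qed.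

(* Kronecker product: (A *t B) *m (v *t w) = (A *m v) *t (B *m w). *)
Definition tens_rep (d1 d2 : nat) (rho1 : su2_rep R d1) (rho2 : su2_rep R d2) :
    su2_rep R (d1 * d2) :=
  Su2Rep (rep_fun := fun g => rho1 g *t rho2 g)
    (tens_rep_one rho1 rho2) (@tens_rep_mul _ _ rho1 rho2).

Fact dsum_rep_one (N : nat) (d : 'I_N -> nat)
    (sigma : forall k, su2_rep R (d k)) :
  \mxdiag_k sigma k 1%:M = 1%:M.
Proof. by rewrite -mxdiagZ; apply: eq_mxdiag => k; rewrite rep_one. Qed.

Fact dsum_rep_mul (N : nat) (d : 'I_N -> nat)
    (sigma : forall k, su2_rep R (d k)) (g h : 'M[Cplx R]_2) :
  SU2 g -> SU2 h ->
  \mxdiag_k sigma k (g *m h) =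
    (\mxdiag_k sigma k g) *m (\mxdiag_k sigma k h).
Proof.
move=> gS hS; rewrite [X in _ = _ *m X]/mxdiag mul_mxdiag_mxblock.
apply: eq_mxblock => i j; case: eqVneq => [<-|_]; last by rewrite mulmx0.
by rewrite !conform_mx_id rep_mul.
Qed.

Definition dsum_rep (N : nat) (d : 'I_N -> nat)
    (sigma : forall k, su2_rep R (d k)) : su2_rep R (\sum_k d k) :=
  Su2Rep (rep_fun := fun g => \mxdiag_k sigma k g)
    (dsum_rep_one sigma) (@dsum_rep_mul _ _ sigma).

End Constructions.

Definition half_integer (s : rat) : Prop := exists n : nat, s = n%:R / 2%:R.

(* "rho is (a model of) V_s". *)
Definition is_spin_rep (R : realType) (s : rat) (d : nat) (rho : su2_rep R d) :
    Prop :=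
  [/\ d%:R = 2%:R * s + 1, rep_continuous rho & rep_irreducible rho].

(* Main.v *)
(* Write [S n] for the action of SU(2) on binary forms of degree [n].
   A continuous representation restricted to the maximal torus is simultaneously
   triangularizable, and a continuous character of the circle is a power of the
   variable; by Weyl symmetry, twice its trace is a sum of [z^k + z^-k], hence an
   integral combination of the characters of the [S n].  Characters of pairwise
   nonisomorphic irreducible representations being linearly independent (an
   algebraic fact, proved by a minimal-support argument instead of Haar
   integration), every continuous irreducible representation of dimension [n + 1]
   is isomorphic to [S n].  The transvectants, sending [x^a (x) y^b] to
   [det(x, y)^k x^(a - k) y^(b - k)], are nonzero intertwiners from
   [S a (x) S b] to each [S (a + b - 2 k)]; these targets are irreducible and
   pairwise nonisomorphic, so the joint map is onto their direct sum, and it is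
   bijective since the dimensions agree. *)
Require Import Defs.
From HB Require Import structures.
From mathcomp Require Import all_boot all_order all_algebra.
From mathcomp Require Import mxtens complex.
From mathcomp Require Import all_classical all_reals all_analysis.
From mathcomp Require Import ring lra zify.

Set Implicit Arguments.
Unset Strict Implicit.
Unset Printing Implicit Defensive.

Import Order.TTheory GRing.Theory Num.Theory.
Import numFieldNormedType.Exports.

Local Open Scope ring_scope.

(** * Irreducible families of matrices *)

(** Subspaces are [Prop]-valued so that kernels, images and other sets given by existential formulas
    count as subspaces without a basis. *)
Definition lin_closed (K : fieldType) (V : lmodType K) (P : V -> Prop) : Prop :=
  P 0 /\ forall c u v, P u -> P v -> P (c *: u + v).

(** Among the subspaces contained in [P], take one of largest dimension: adding the line of any
    vector of [P] cannot enlarge it. *)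
Lemma lin_closed_vspace (K : fieldType) (V : vectType K) (P : V -> Prop) :
  lin_closed P -> exists U : {vspace V}, forall v, v \in U <-> P v.
Proof.
case=> P0 PL.
pose Q n := `[< exists U : {vspace V}, (forall v, v \in U -> P v) /\ \dim U = n >].
have exQ : exists n, Q n.
  exists 0%N; apply/asboolP; exists 0%VS; split; last exact: dimv0.
  by move=> v; rewrite memv0 => /eqP ->.
have ubQ n : Q n -> (n <= \dim {:V})%N.
  by move=> /asboolP[U [_ <-]]; rewrite dimvS ?subvf.
case: (ex_maxnP exQ ubQ) => n /asboolP[U [UP dimU]] maxn_.
exists U => v; split=> [/UP //|Pv].
have sub : (U <= U + <[v]>)%VS by exact: addvSl.
suff defU : U = (U + <[v]>)%VS by rewrite defU (subvP (addvSr U <[v]>%VS)) ?memv_line.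
apply/eqP; rewrite eqEdim sub /= dimU; apply: maxn_; apply/asboolP.
exists (U + <[v]>)%VS; split=> // _ /memv_addP[u uU [_ /vlineP[c ->] ->]].
by rewrite addrC; apply: PL => //; apply: UP.
Qed.

Section Families.
Variables (C : numClosedFieldType) (G : Type).

Definition fam_stable d (f : G -> 'M[C]_d) (P : 'cV[C]_d -> Prop) : Prop :=
  forall g v, P v -> P (f g *m v).

(** [G] is a bare index set here, so that the notion serves both for SU(2) and for the
    one-dimensional weights of the circle. *)
Definition fam_irr d (f : G -> 'M[C]_d) : Prop :=
  (0 < d)%N /\ forall P : 'cV[C]_d -> Prop, lin_closed P -> fam_stable f P ->
    forall u, P u -> u != 0 -> forall v, P v.

Definition intertwines d d' (f : G -> 'M[C]_d) (f' : G -> 'M[C]_d')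
    (T : 'M[C]_(d', d)) : Prop :=
  forall g, T *m f g = f' g *m T.

Lemma mulmx_deltaE m n (A : 'M[C]_(m, n)) j : A *m delta_mx j 0 = col j A :> 'cV_m.
Proof. by rewrite colE. Qed.

Lemma eq_mulmx_cV m n (A B : 'M[C]_(m, n)) :
  (forall v : 'cV_n, A *m v = B *m v) -> A = B.
Proof.
move=> eqAB; apply/matrixP => i j.
by have /colP/(_ i) := eqAB (delta_mx j 0); rewrite !mulmx_deltaE !mxE.
Qed.

Lemma linear_colfun_mx m n (phi : 'cV[C]_m -> 'cV[C]_n) :
  (forall c u v, phi (c *: u + v) = c *: phi u + phi v) ->
  exists T : 'M[C]_(n, m), forall v, phi v = T *m v.
Proof.
move=> phiL.
have phi0 : phi 0 = 0.
  by have := phiL (-1) 0 0; rewrite scaler0 addr0 scaleN1r addNr.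
have phiS (r : seq 'I_m) (F : 'I_m -> C) : phi (\sum_(j <- r) F j *: delta_mx j 0) =
    \sum_(j <- r) F j *: phi (delta_mx j 0).
  by elim: r => [|j r IH]; rewrite ?big_nil // !big_cons phiL IH.
exists (\matrix_(i, j) phi (delta_mx j 0) i 0) => v.
rewrite {1}(matrix_sum_delta v) (eq_bigr (fun j => v j 0 *: delta_mx j 0)); last first.
  by move=> j _; rewrite big_ord1.
rewrite phiS; apply/colP => i; rewrite summxE mxE; apply: eq_bigr => j _.
by rewrite !mxE mulrC.
Qed.

(** The kernel and the image of [T] are stable, so [T] is bijective; a chosen section is linear
    because [T] is injective. *)
Lemma schur_iso d d' (f : G -> 'M[C]_d) (f' : G -> 'M[C]_d') (T : 'M[C]_(d', d)) :
  fam_irr f -> fam_irr f' -> intertwines f f' T -> T != 0 ->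
  exists2 S : 'M[C]_(d, d'), T *m S = 1%:M & S *m T = 1%:M.
Proof.
move=> [_ irrf] [_ irrf'] fT T0.
have inj (v : 'cV_d) : T *m v = 0 -> v = 0.
  move=> Tv0; apply/eqP/negPn/negP => v0; move/eqP: T0; apply.
  apply: eq_mulmx_cV => u; rewrite mul0mx.
  apply: (irrf (fun u => T *m u = 0) _ _ v) => //.
    split=> [|c u1 u2 h1 h2]; first by rewrite mulmx0.
    by rewrite mulmxDr -scalemxAr h1 h2 scaler0 addr0.
  by move=> g u1 h; rewrite mulmxA fT -mulmxA h mulmx0.
have [v Tv0] : exists v : 'cV_d, T *m v != 0.
  apply: contrapT => h; move/eqP: T0; apply; apply: eq_mulmx_cV => v.
  rewrite mul0mx; apply: contrapT => Tv; apply: h; exists v; exact/eqP.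
have surj (w : 'cV_d') : exists v : 'cV_d, T *m v = w.
  apply: (irrf' (fun w => exists v : 'cV_d, T *m v = w) _ _ (T *m v)) => //; last by exists v.
    split=> [|c _ _ [u1 <-] [u2 <-]]; first by exists 0; rewrite mulmx0.
    by exists (c *: u1 + u2); rewrite mulmxDr -scalemxAr.
  by move=> g _ [u <-]; exists (f g *m u); rewrite mulmxA fT mulmxA.
have [phi phiP] := choice surj.
have [S SP] : exists S : 'M[C]_(d, d'), forall v, phi v = S *m v.
  apply: linear_colfun_mx => c u w; apply/eqP; rewrite -subr_eq0; apply/eqP/inj.
  by rewrite mulmxBr mulmxDr -scalemxAr !phiP subrr.
have TS : T *m S = 1%:M by apply: eq_mulmx_cV => w; rewrite -mulmxA -SP phiP mul1mx.
exists S => //; apply: eq_mulmx_cV => w; apply/eqP; rewrite -subr_eq0; apply/eqP/inj.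
by rewrite mulmxBr mulmxA mulmxA TS !mul1mx subrr.
Qed.

(** An eigenspace is stable, and a nonzero one exists since the field is algebraically closed and
    [d] is positive. *)
Lemma schur_scalar d (f : G -> 'M[C]_d) (T : 'M[C]_d) :
  fam_irr f -> intertwines f f T -> exists c, T = c%:M.
Proof.
move=> [d0 irrf] fT.
(* Eigenvectors are row vectors here, whence the transpose. *)
have [c /eigenvalueP[v vT v0]] := eigenvalue_closed T^T d0.
exists c; apply: eq_mulmx_cV => u; rewrite mul_scalar_mx.
apply: (irrf (fun u => T *m u = c *: u) _ _ v^T).
- split=> [|a u1 u2 h1 h2]; first by rewrite mulmx0 scaler0.
  by rewrite mulmxDr -scalemxAr h1 h2 scalerDr !scalerA mulrC.
- by move=> g u1 h; rewrite mulmxA fT -mulmxA h scalemxAr.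
- by apply: trmx_inj; rewrite trmx_mul trmxK vT linearZ /= trmxK.
- by rewrite trmx_eq0.
Qed.

Section Goursat.
Variables (I : finType) (d : I -> nat) (f : forall i, G -> 'M[C]_(d i)).
Hypothesis irrf : forall i, fam_irr (f i).

(* An element of minimal support [S] generates the graph of a family of
   intertwiners: two elements supported in [S] that agree in one coordinate of
   [S] differ by an element of smaller support. *)
Lemma goursat (R : (forall i, 'cV[C]_(d i)) -> Prop) a0 i0 :
  (forall c a b, R a -> R b -> R (fun i => c *: a i + b i)) ->
  (forall g a, R a -> R (fun i => f i g *m a i)) ->
  R a0 -> a0 i0 != 0 ->
  exists s (T : forall i, 'M[C]_(d i, d s)),
    [/\ T s = 1%:M, forall i, intertwines (f s) (f i) (T i) &
        forall v, R (fun i => T i *m v)].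
Proof.
move=> RL Rf Ra0 a00.
pose supp (a : forall i, 'cV[C]_(d i)) := [set i | a i != 0].
pose Q n := `[< exists a i, [/\ R a, a i != 0 & #|supp a| = n] >].
have exQ : exists n, Q n by exists #|supp a0|; apply/asboolP; exists a0, i0.
case: (ex_minnP exQ) => n /asboolP[a [s [Ra as0 <-]]] mina.
have uniq_supp b : R b -> supp b \subset supp a -> b s = 0 -> forall i, b i = 0.
  move=> Rb sb bs i; apply/eqP/negPn/negP => bi.
  have : (#|supp a| <= #|supp b|)%N by apply: mina; apply/asboolP; exists b, i.
  rewrite leqNgt => /negP; apply; apply: proper_card; apply/properP; split=> //.
  by exists s; rewrite !inE ?as0 // bs eqxx.
(* [P] collects the [s]-coordinates of the elements supported in [supp a]. It is stable and contains
   [a s], hence is everything, and by [uniq_supp] each such element is determined by its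
   [s]-coordinate. *)
pose P v := exists b, [/\ R b, supp b \subset supp a & b s = v].
have RB b b' : R b -> R b' -> R (fun i => b i - b' i).
  move=> Rb Rb'; suff -> : (fun i => b i - b' i) = (fun i => (-1) *: b' i + b i).
    exact: RL.
  by apply: functional_extensionality_dep => i; rewrite scaleN1r addrC.
have suppL c b b' : supp b \subset supp a -> supp b' \subset supp a ->
    supp (fun i => c *: b i + b' i) \subset supp a.
  move=> /fintype.subsetP h /fintype.subsetP h'; apply/fintype.subsetP => i; rewrite !inE => cb.
  have [bi|bi] := eqVneq (b i) 0; last by have := h i; rewrite !inE; apply.
  by have := h' i; rewrite !inE; apply; move: cb; rewrite bi scaler0 add0r.
have PT v : P v.
  apply: ((irrf s).2 P _ _ (a s)) => //; last by exists a.
    split=> [|c u w [b [Rb sb <-]] [b' [Rb' sb' <-]]].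
      exists (fun i => a i - a i); split; [exact: RB | | exact: subrr].
      by apply/fintype.subsetP => i; rewrite !inE subrr eqxx.
    by exists (fun i => c *: b i + b' i); split; [exact: RL | exact: suppL |].
  move=> g _ [b [Rb sb <-]]; exists (fun i => f i g *m b i); split=> //; first exact: Rf.
  apply/fintype.subsetP => i; rewrite inE => fb; apply: (fintype.subsetP sb); rewrite inE.
  by apply: contraNneq fb => ->; rewrite mulmx0.
have [phi phiP] := choice PT.
have eq_phi b v : R b -> supp b \subset supp a -> b s = v -> forall i, phi v i = b i.
  move=> Rb sb bs i; have [Rv sv vs] := phiP v; apply/eqP; rewrite -subr_eq0; apply/eqP.
  apply: (uniq_supp (fun i => phi v i - b i)); first exact: RB.
    suff -> : supp (fun i => phi v i - b i) = supp (fun i => (-1) *: b i + phi v i).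
      exact: suppL.
    by apply/setP => j; rewrite !inE scaleN1r addrC.
  by rewrite vs bs subrr.
have phiL i : exists T : 'M[C]_(d i, d s), forall v, phi v i = T *m v.
  apply: linear_colfun_mx => c u v.
  have [Ru su us] := phiP u; have [Rv sv vs] := phiP v.
  apply: (eq_phi (fun i => c *: phi u i + phi v i)); last by rewrite us vs.
    exact: RL.
  exact: suppL.
have [T TP] : exists T : forall i, 'M[C]_(d i, d s), forall i v, phi v i = T i *m v.
  pose T i := projT1 (cid (phiL i)); exists T => i v.
  exact: (projT2 (cid (phiL i))).
exists s, T; split.
- apply: eq_mulmx_cV => v; rewrite -TP mul1mx; by have [] := phiP v.
- move=> i g; apply: eq_mulmx_cV => v; rewrite -!mulmxA -!TP.
  have [Rv sv vs] := phiP v; apply: (eq_phi (fun i => f i g *m phi v i)).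
  + exact: Rf.
  + apply/fintype.subsetP => j; rewrite inE => fb; apply: (fintype.subsetP sv); rewrite inE.
    by apply: contraNneq fb => ->; rewrite mulmx0.
  + by rewrite vs.
- move=> v; have [Rv _ _] := phiP v.
  suff -> : (fun i => T i *m v) = phi v by [].
  by apply: functional_extensionality_dep => i; rewrite TP.
Qed.

Hypothesis noniso : forall i j T, i != j -> intertwines (f i) (f j) T -> T = 0.

(** Without intertwiners between different summands, the graph supplied by [goursat] is a single
    summand. So once the coordinates in summands lying wholly in [R] are removed, nothing is
    left. *)
Lemma invariant_component (R : (forall i, 'cV[C]_(d i)) -> Prop) :
  R (fun=> 0) ->
  (forall c a b, R a -> R b -> R (fun i => c *: a i + b i)) ->
  (forall g a, R a -> R (fun i => f i g *m a i)) ->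
  forall a s, R a -> R (fun i => if i == s then a i else 0).
Proof.
move=> R0 RL Rf a s Ra.
pose full := [set i | `[< forall b, R (fun j => if j == i then b j else 0) >]].
have fullP i b : i \in full -> R (fun j => if j == i then b j else 0).
  by rewrite inE => /asboolP; apply.
have [/fullP sF|s_full] := boolP (s \in full); first exact: sF.
pose R' b := R b /\ forall i, i \in full -> b i = 0.
pose a' i : 'cV_(d i) := if i \in full then 0 else a i.
have Ra' : R' a'.
  split=> [|i]; last by rewrite /a' => ->.
  have Rr (r : seq I) : {subset r <= full} -> R (fun i => if i \in r then 0 else a i).
    elim: r => [|i r IH] rs; first exact: Ra.
    have ifull : i \in full by apply: rs; rewrite mem_head.
    have {}IH := IH (fun j jr => rs j (@mem_behead _ (i :: r) j jr)).
    have := RL (-1) _ _ (fullP i (fun i => if i \in r then 0 else a i) ifull) IH.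
    congr R; apply: functional_extensionality_dep => j; rewrite inE.
    have [->|] := eqVneq j i; first by rewrite scaleN1r addNr.
    by rewrite scaler0 add0r.
  have := Rr (enum full) (fun i => etrans (esym (mem_enum _ i))).
  congr R; apply: functional_extensionality_dep => j.
  by rewrite /a' mem_enum.
have [a'0|/existsNP[i0 /eqP a'i0]] := pselect (forall i, a' i = 0).
  suff -> : (fun i => if i == s then a i else 0) = (fun=> 0) by [].
  apply: functional_extensionality_dep => i; have [->|//] := eqVneq i s.
  by have := a'0 s; rewrite /a' (negPf s_full).
(* A nonzero remainder gives, among the elements of [R] vanishing on [full], a graph over some [s'].
   Its other components are zero, so [s'] is in [full]; but then coordinate [s'] must vanish while
   [T s'] is the identity. *)
have [||s' [T [Ts Tf RT]]] := goursat (R := R') _ _ Ra' a'i0.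
- move=> c u v [Ru uF] [Rv vF]; split=> [|i iF]; first exact: RL.
  by rewrite uF // vF // scaler0 addr0.
- move=> g u [Ru uF]; split=> [|i iF]; first exact: Rf.
  by rewrite uF // mulmx0.
have s'F : s' \in full.
  rewrite inE; apply/asboolP => b; have [RTb _] := RT (b s').
  suff -> : (fun i => if i == s' then b i else 0) = (fun i => T i *m b s') by [].
  apply: functional_extensionality_dep => i.
  have [->|/negPf ni] := eqVneq i s'; first by rewrite Ts mul1mx.
  rewrite (noniso _ (Tf i)) ?mul0mx //. by rewrite eq_sym ni.
have [d0 _] := irrf s'.
have [_ H0] := RT (const_mx 1); have := H0 s' s'F.
by rewrite Ts mul1mx => /colP/(_ (Ordinal d0))/eqP; rewrite !mxE oner_eq0.
Qed.
End Goursat.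

(** Take one copy of [f i] for each coordinate [j], and put [c i] times the [j]-th basis vector into
    copy [(i, j)]: the relation between traces says that this vector lies in the invariant subspace
    [R]. Since [goursat] admits isomorphic summands, it yields a graph inside [R], whose components
    are zero or scalar by Schur. *)
Lemma trace_independent (I : finType) (d : I -> nat) (f : forall i, G -> 'M[C]_(d i))
    (e : G) (op : G -> G -> G) (c : I -> C) :
  (forall i, fam_irr (f i)) ->
  (forall i j T, i != j -> intertwines (f i) (f j) T -> T = 0) ->
  (forall i, f i e = 1%:M) -> (forall i g h, f i (op g h) = f i g *m f i h) ->
  (forall g, \sum_i c i * \tr (f i g) = 0) -> forall i, c i = 0.
Proof.
move=> irrf noniso f1 fM trc i0; apply/eqP/negPn/negP => c0.
pose J := {i : I & 'I_(d i)}; pose f' (p : J) := f (tag p).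
pose R (a : forall p : J, 'cV[C]_(d (tag p))) :=
  forall g, \sum_p (f' p g *m a p) (tagged p) 0 = 0.
pose a0 (p : J) : 'cV[C]_(d (tag p)) := c (tag p) *: delta_mx (tagged p) 0.
have Ra0 : R a0.
  move=> g; rewrite -[RHS](trc g).
  rewrite (eq_bigr (fun i => \sum_j (c i * f i g j j))); last first.
    by move=> i _; rewrite /mxtrace mulr_sumr.
  rewrite sig_big_dep /=; apply: eq_bigr => p _.
  by rewrite /a0 -scalemxAr mulmx_deltaE !mxE.
have [d0 _] := irrf i0.
pose p0 : J := Tagged (fun i => 'I_(d i)) (Ordinal d0).
have a00 : a0 p0 != 0.
  apply/eqP => /colP/(_ (Ordinal d0))/eqP.
  by rewrite !mxE !eqxx mulr1 (negPf c0).
have [|||s [T [Ts Tf RT]]] := @goursat J (fun p => d (tag p)) f' _ R a0 p0 _ _ Ra0 a00.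
- by move=> p; apply: irrf.
- move=> k a b Ra Rb g.
  rewrite (eq_bigr (fun p => k * (f' p g *m a p) (tagged p) 0 + (f' p g *m b p) (tagged p) 0)).
    by rewrite big_split /= -mulr_sumr Ra Rb mulr0 addr0.
  by move=> p _; rewrite mulmxDr -scalemxAr !mxE.
- move=> h a Ra g; rewrite -[RHS](Ra (op g h)); apply: eq_bigr => p _.
  by rewrite /f' fM mulmxA.
(* At the unit only the term [p = s] survives: a scalar keeps the basis vector [tagged s] on its own
   line, so the coordinate read in any other copy is zero. The relation becomes [1 = 0]. *)
have := RT (delta_mx (tagged s) 0) e.
rewrite (bigD1 s) //= Ts mul1mx /f' f1 mul1mx mxE !eqxx big1 ?addr0 => [/eqP|p ps].
  by rewrite oner_eq0.
rewrite f1 mul1mx; case: p ps (Tf p) => i j; case: s {RT Tf} T Ts => i' j' /= T Ts ps Tf.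
case: (eqVneq i' i) => [eqi|ni]; last by rewrite (noniso _ _ _ ni Tf) mul0mx mxE.
case: i / eqi j ps Tf => j ps Tf.
have [k ->] := schur_scalar (irrf i') Tf.
rewrite mul_scalar_mx !mxE; case: (eqVneq j j') => [jj'|_]; last by rewrite mulr0.
by case/eqP: ps; rewrite jj'.
Qed.
End Families.

(** * Binary forms and transvectants *)

Section SymModel.
Variable C : numClosedFieldType.
Implicit Types (x y : 'cV[C]_2) (g h : 'M[C]_2) (p q A B : {poly C}).

(** Binary forms are dehomogenised: a vector stands for a linear form, with ['X] in place of the
    second basis vector, and forms of degree [n] become polynomials of degree at most [n]. *)
Definition lin x : {poly C} := (x 0 0)%:P + x 1 0 *: 'X.

Definition coefvec n p : 'cV[C]_n.+1 := \col_i p`_i.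

(** The action on forms of degree [n]: column [j] is the image of the monomial of exponents [n - j]
    and [j], obtained by substituting the columns of [g] for the basis vectors. *)
Definition sym n g : 'M[C]_n.+1 :=
  \matrix_(i, j) (lin (col 0 g) ^+ (n - j) * lin (col 1 g) ^+ j)`_i.

(** Substitution of [A] and [B] into the degree-[n] homogenisation of [p]. *)
Definition homog n A B p : {poly C} := \sum_(j < n.+1) p`_j *: (A ^+ (n - j) * B ^+ j).

Lemma lin_mul g x : lin (g *m x) = x 0 0 *: lin (col 0 g) + x 1 0 *: lin (col 1 g).
Proof.
rewrite /lin !mxE !big_ord_recl !big_ord0 /=.
have -> : lift ord0 ord0 = 1 :> 'I_2 by apply/val_inj.
rewrite -!alg_polyC !addr0 !scalerDr !scalerA !scalerDl !(mulrC (x _ _)).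
by rewrite addrACA.
Qed.

Lemma size_lin_exp x n : (size (lin x ^+ n) <= n.+1)%N.
Proof.
have slin : (size (lin x) <= 2)%N.
  rewrite (leq_trans (size_polyD _ _)) // geq_max (leq_trans (size_polyC_leq1 _)) //.
  by rewrite (leq_trans (size_scale_leq _ _)) ?size_polyX.
elim: n => [|n IH]; first by rewrite expr0 size_poly1.
rewrite exprS (leq_trans (size_polyMleq _ _)) //.
by move: slin IH; lia.
Qed.

Lemma coef_lin_exp x n i :
  (lin x ^+ n)`_i = if (i <= n)%N then x 0 0 ^+ (n - i) * x 1 0 ^+ i *+ 'C(n, i) else 0.
Proof.
case: ifP => [le_in|/negbT]; last first.
  by rewrite -ltnNge => ni; rewrite nth_default // (leq_trans (size_lin_exp _ _)).
rewrite /lin exprDn coef_sum (bigD1 (Ordinal (le_in : (i < n.+1)%N))) //= big1 => [|j ji].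
  by rewrite addr0 coefMn -rmorphXn /= coefCM exprZn coefZ coefXn eqxx mulr1.
rewrite coefMn -rmorphXn /= coefCM exprZn coefZ coefXn.
case: eqP => [e|_]; last by rewrite !mulr0 mul0rn.
by case/eqP: ji; apply/val_inj.
Qed.

Lemma sym_coefvec n g p :
  sym n g *m coefvec n p = coefvec n (homog n (lin (col 0 g)) (lin (col 1 g)) p).
Proof.
apply/colP => i; rewrite !mxE coef_sum; apply: eq_bigr => j _.
by rewrite !mxE coefZ mulrC.
Qed.

Lemma homogS_lin n A B x p : (size p <= n.+1)%N ->
  homog n.+1 A B (lin x * p) = (x 0 0 *: A + x 1 0 *: B) * homog n A B p.
Proof.
move=> sp; rewrite /homog.
transitivity (x 0 0 *: \sum_(j < n.+2) p`_j *: (A ^+ (n.+1 - j) * B ^+ j) +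
   x 1 0 *: \sum_(j < n.+2) ('X * p)`_j *: (A ^+ (n.+1 - j) * B ^+ j)).
  rewrite !scaler_sumr -big_split /=; apply: eq_bigr => j _.
  by rewrite /lin mulrDl coefD coefCM -scalerAl coefZ scalerDl !scalerA.
rewrite mulrDl -!scalerAl !mulr_sumr; congr (_ *: _ + _ *: _).
  (* The first sum has one more term than [homog n]; the size bound on [p] makes its coefficient
     zero. *)
  rewrite big_ord_recr /= nth_default // scale0r addr0; apply: eq_bigr => j _.
  by rewrite -scalerAr mulrA -exprS subSn // -ltnS.
rewrite big_ord_recl /= coefXM eqxx scale0r add0r; apply: eq_bigr => j _.
by rewrite coefXM /= subSS -scalerAr mulrCA -exprS.
Qed.

(** Linear factors are peeled off one at a time by [homogS_lin]. This makes [sym] multiplicative and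
    the transvectants equivariant. *)
Lemma sym_lin n k g x y : (k <= n)%N ->
  sym n g *m coefvec n (lin x ^+ (n - k) * lin y ^+ k) =
  coefvec n (lin (g *m x) ^+ (n - k) * lin (g *m y) ^+ k).
Proof.
move=> le_kn; rewrite sym_coefvec; congr (coefvec n _).
rewrite !lin_mul; set A := lin (col 0 g); set B := lin (col 1 g).
have Hy m : homog m A B (lin y ^+ m) = (y 0 0 *: A + y 1 0 *: B) ^+ m.
  elim: m => [|m IH]; first by rewrite /homog big_ord1 !expr0 coef1 scale1r mulr1.
  by rewrite exprS homogS_lin ?size_lin_exp // IH -exprS.
have Hx m : homog (m + k) A B (lin x ^+ m * lin y ^+ k) =
    (x 0 0 *: A + x 1 0 *: B) ^+ m * (y 0 0 *: A + y 1 0 *: B) ^+ k.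
  elim: m => [|m IH]; first by rewrite !expr0 !mul1r Hy.
  rewrite exprS -mulrA addSn homogS_lin ?IH ?mulrA -?exprS //.
  rewrite (leq_trans (size_polyMleq _ _)) //.
  by have := size_lin_exp x m; have := size_lin_exp y k; lia.
by rewrite -{1}(subnK le_kn) Hx.
Qed.

Lemma col_sym n g j :
  col j (sym n g) = coefvec n (lin (col 0 g) ^+ (n - j) * lin (col 1 g) ^+ j).
Proof. by apply/colP => i; rewrite !mxE. Qed.

Lemma sym_mul n g h : sym n (g *m h) = sym n g *m sym n h.
Proof.
have eq_col (M N : 'M[C]_n.+1) : (forall j, col j M = col j N) -> M = N.
  by move=> MN; apply/matrixP => i j; have /colP/(_ i) := MN j; rewrite !mxE.
have col_mulmx k (M N : 'M[C]_k) j : col j (M *m N) = M *m col j N.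
  by rewrite !colE mulmxA.
apply: eq_col => j; rewrite col_mulmx !col_sym sym_lin -1?ltnS //.
by rewrite !col_mulmx.
Qed.

Definition tor (z : C) : 'M[C]_2 :=
  diag_mx (\row_i if i == 0 then z else z^-1).

Lemma sym_tor n z i j : sym n (tor z) i j = (z ^+ (n - j) * z^-1 ^+ j) *+ (i == j).
Proof.
rewrite mxE; have -> : lin (col 0 (tor z)) = z%:P.
  by rewrite /lin !mxE /= scale0r addr0.
have -> : lin (col 1 (tor z)) = z^-1 *: 'X.
  by rewrite /lin !mxE /= polyC0 add0r.
by rewrite -rmorphXn /= coefCM exprZn coefZ coefXn mulrA -val_eqE /= mulr_natr.
Qed.

Lemma tor1 : tor 1 = 1%:M.
Proof.
apply/matrixP => i j; rewrite !mxE invr1; by case: (i == 0).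
Qed.

Lemma sym1 n : sym n 1%:M = 1%:M.
Proof.
apply/matrixP => i j; rewrite -tor1 sym_tor invr1 !expr1n mulr1 mxE.
by [].
Qed.

Lemma mxtrace_sym_tor n z : \tr (sym n (tor z)) = \sum_(j < n.+1) z ^+ (n - j) * z^-1 ^+ j.
Proof. by apply: eq_bigr => j _; rewrite sym_tor eqxx. Qed.

(** * Spanning by powers of linear forms *)

Lemma coef_eq0_of_roots n (c : 'I_n -> C) :
  (forall s, \sum_j c j * s ^+ j = 0) -> forall j, c j = 0.
Proof.
move=> c0 j; pose p := \poly_(i < n) (if insub i is Some j then c j else 0).
suff p0 : p = 0.
  have := coef_poly n (fun i => if insub i is Some j then c j else 0) j.
  by rewrite -/p p0 coef0 ltn_ord valK.
apply/eqP/negPn/negP => p0.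
(* The integers below [n] are [n] distinct roots, the characteristic being zero. *)
pose rs := [seq i%:R : C | i <- iota 0 n].
have /(max_poly_roots p0) : all (root p) rs.
  apply/allP => s _; apply/rootP; rewrite horner_poly -[RHS](c0 s).
  by apply: eq_bigr => i _; rewrite valK.
rewrite size_map size_iota map_inj_uniq ?iota_uniq => [/(_ isT)|a b /eqP]; last first.
  by rewrite eqr_nat => /eqP.
by rewrite ltnNge size_poly.
Qed.

Definition veronese n x : 'cV[C]_n.+1 := coefvec n (lin x ^+ n).

(** At [x = (1, s)] each entry is a polynomial in [s] whose coefficients are entries of [N] times
    binomial coefficients, and these are nonzero in characteristic zero. *)
Lemma veronese_span m n (N : 'M[C]_(m, n.+1)) :
  (forall x, N *m veronese n x = 0) -> N = 0.
Proof.
move=> N0; apply/matrixP => i j; rewrite mxE.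
have := @coef_eq0_of_roots n.+1 (fun j => N i j *+ 'C(n, j)) _ j.
move=> /(_ _)/eqP; rewrite mulrn_eq0 -leqn0 leqNgt bin_gt0 -ltnS ltn_ord /=.
move=> h; apply/eqP/h => s {h}.
have /colP/(_ i) := N0 (\col_i if i == 0 then 1 else s); rewrite !mxE => N0s.
rewrite -[RHS]N0s; apply: eq_bigr => k _.
by rewrite mxE coef_lin_exp -ltnS ltn_ord !mxE /= expr1n mul1r mulrnAr mulrnAl.
Qed.

(** Both sides are bilinear, so [veronese_span] extends the equality to all [u *t v], one factor at
    a time, and these include the standard basis. *)
Lemma tens_veronese_span m a b (M N : 'M[C]_(m, a.+1 * b.+1)) :
  (forall x y, M *m (veronese a x *t veronese b y) = N *m (veronese a x *t veronese b y)) ->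
  M = N.
Proof.
move=> MN.
have tensL u v c u' : (c *: u + u') *t v = c *: (u *t v) + u' *t v :> 'M[C]_(a.+1 * b.+1, 1 * 1).
  by move=> *; apply/matrixP => i j; rewrite !mxE mulrDl mulrA.
have tensR u v c v' : u *t (c *: v + v') = c *: (u *t v) + u *t v' :> 'M[C]_(a.+1 * b.+1, 1 * 1).
  by move=> *; apply/matrixP => i j; rewrite !mxE mulrDr mulrCA.
apply/eqP; rewrite -subr_eq0; apply/eqP; set D := M - N.
have lin_vanish c (psi : 'cV[C]_c.+1 -> 'M[C]_(m, 1 * 1)) :
    (forall k u v, psi (k *: u + v) = k *: psi u + psi v) ->
    (forall x, psi (veronese c x) = 0) -> forall u, psi u = 0.
  move=> psiL psi0 u; have [T TP] := @linear_colfun_mx C c.+1 m psi psiL.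
  by rewrite TP (@veronese_span m c T) ?mul0mx // => x; rewrite -TP psi0.
have D1 x (v : 'cV_b.+1) : D *m (veronese a x *t v) = 0.
  move: v; apply: (lin_vanish b (fun v => D *m (veronese a x *t v))) => [k u v|y].
    by rewrite tensR mulmxDr -scalemxAr.
  by rewrite mulmxBl MN subrr.
have D2 (u : 'cV_a.+1) (v : 'cV_b.+1) : D *m (u *t v) = 0.
  move: u; apply: (lin_vanish a (fun u => D *m (u *t v))) => [k u w|x]; last exact: D1.
  by rewrite tensL mulmxDr -scalemxAr.
apply/matrixP => i p; have := D2 (delta_mx (mxtens_unindex p).1 0) (delta_mx (mxtens_unindex p).2 0).
move=> /matrixP/(_ i 0); rewrite !mxE => <-.
rewrite (bigD1 p) //= big1 ?addr0 => [|q qp]; rewrite !mxE /= !(ord1 (Ordinal _)) !eqxx.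
  by rewrite !andbT !mulr1.
rewrite !andbT -natrM mulnb; case: andP => [[/eqP e1 /eqP e2]|_]; last by rewrite mulr0.
by case/eqP: qp; apply: (can_inj (@mxtens_unindexK a.+1 b.+1)); congr pair.
Qed.

(** * Transvectants *)

Definition det2 x y : C := x 0 0 * y 1 0 - x 1 0 * y 0 0.

Lemma det2_mul g x y : det2 (g *m x) (g *m y) = \det g * det2 x y.
Proof.
rewrite (expand_det_row _ 0) /cofactor !big_ord_recl big_ord0 !det_mx11 /det2 !mxE.
rewrite !big_ord_recl !big_ord0 /=.
have -> : lift ord0 ord0 = 1 :> 'I_2 by apply/val_inj.
have -> : lift 1 0 = 0 :> 'I_2 by apply/val_inj.
have -> : ord0 = 0 :> 'I_2 by [].
rewrite /bump leqnn !addn0 add0n expr0 expr1; ring.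
Qed.

(** Bihomogeneous polynomial functions of degree [a] in [x] and [b] in [y], generated inductively so
    that their properties follow by induction on the derivation. *)
Inductive biform : nat -> nat -> ('cV[C]_2 -> 'cV[C]_2 -> C) -> Prop :=
| BiformMono a b i j : (i <= a)%N -> (j <= b)%N ->
    biform a b (fun x y => x 0 0 ^+ (a - i) * x 1 0 ^+ i * (y 0 0 ^+ (b - j) * y 1 0 ^+ j))
| Biform0 a b : biform a b (fun _ _ => 0)
| BiformL a b c phi psi : biform a b phi -> biform a b psi ->
    biform a b (fun x y => c * phi x y + psi x y).

Lemma biform_ext a b phi psi : biform a b phi -> (forall x y, phi x y = psi x y) ->
  biform a b psi.
Proof. by move=> ? e; suff <- : phi = psi by []; do 2!apply: funext => ?. Qed.

Lemma biform_sum a b (I : Type) (r : seq I) (c : I -> C) (phi : I -> _) :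
  (forall i, biform a b (phi i)) -> biform a b (fun x y => \sum_(i <- r) c i * phi i x y).
Proof.
move=> phiB; elim: r => [|i r IH].
  by apply: biform_ext (Biform0 a b) _ => x y; rewrite big_nil.
by apply: biform_ext (BiformL (c i) (phiB i) IH) _ => x y; rewrite big_cons.
Qed.

Lemma biformM a b a' b' phi psi : biform a b phi -> biform a' b' psi ->
  biform (a + a') (b + b') (fun x y => phi x y * psi x y).
Proof.
elim=> {a b phi} [a b i j ia jb|a b|a b c phi1 phi2 _ IH1 _ IH2] psiB; last first.
- apply: biform_ext (BiformL c (IH1 psiB) (IH2 psiB)) _ => x y.
  by rewrite mulrDl mulrA.
- by apply: biform_ext (Biform0 _ _) _ => x y; rewrite mul0r.
elim: psiB => {a' b' psi} [a' b' i' j' ia' jb'|a' b'|a' b' c phi1 phi2 _ IH1 _ IH2].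
- have ii : (i + i' <= a + a')%N by rewrite leq_add.
  have jj : (j + j' <= b + b')%N by rewrite leq_add.
  apply: biform_ext (BiformMono ii jj) _ => x y.
  have -> : (a + a' - (i + i') = (a - i) + (a' - i'))%N by lia.
  have -> : (b + b' - (j + j') = (b - j) + (b' - j'))%N by lia.
  rewrite !exprD; ring.
- by apply: biform_ext (Biform0 _ _) _ => x y; rewrite mulr0.
- by apply: biform_ext (BiformL c IH1 IH2) _ => x y; ring.
Qed.

Lemma biform_row a b phi : biform a b phi ->
  exists r : 'rV[C]_(a.+1 * b.+1), forall x y,
    (r *m (veronese a x *t veronese b y)) 0 0 = phi x y.
Proof.
elim=> {a b phi} [a b i j ia jb|a b|a b c phi1 phi2 _ [r1 IH1] _ [r2 IH2]].
- pose k := mxtens_index (inord i : 'I_a.+1, inord j : 'I_b.+1).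
  (* Coordinate [k] of the tensor of powers is the monomial times two binomial coefficients, which
     are divided out. *)
  exists (('C(a, i) * 'C(b, j))%N%:R^-1 *: delta_mx 0 k) => x y.
  rewrite -scalemxAl -rowE !mxE mxtens_indexK /= !inordK ?ltnS // !coef_lin_exp ia jb.
  rewrite -mulr_natr -[_ *+ 'C(b, j)]mulr_natr natrM.
  have : 'C(a, i)%:R != 0 :> C by rewrite pnatr_eq0 -lt0n bin_gt0.
  have : 'C(b, j)%:R != 0 :> C by rewrite pnatr_eq0 -lt0n bin_gt0.
  by move=> ? ?; field; apply/andP.
- by exists 0 => x y; rewrite mul0mx mxE.
- by exists (c *: r1 + r2) => x y; rewrite mulmxDl -scalemxAl !mxE -IH1 -IH2 !mxE.
Qed.

Lemma biform_det2X k : biform k k (fun x y => det2 x y ^+ k).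
Proof.
elim: k => [|k IH].
  by apply: biform_ext (@BiformMono 0 0 0 0 _ _) _ => // x y; rewrite !expr0 !mulr1.
have d1 : biform 1 1 det2.
  have B1 := @BiformMono 1 1 1 0 isT isT; have B2 := @BiformMono 1 1 0 1 isT isT.
  have B1' := BiformL (-1) B1 (Biform0 1 1).
  apply: biform_ext (BiformL 1 B2 B1') _ => x y.
  by rewrite /det2 !subn0 !subnn !expr0 !expr1; ring.
by apply: biform_ext (biformM d1 IH) _ => x y; rewrite exprS.
Qed.

Lemma biform_lin m l i : biform m l (fun x y => (lin x ^+ m * lin y ^+ l)`_i).
Proof.
pose phi (j : 'I_i.+1) x y := (lin x ^+ m)`_j * (lin y ^+ l)`_(i - j).
have := @biform_sum m l _ (index_enum 'I_i.+1) (fun=> 1) phi.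
move=> h; apply: biform_ext (h _) _ => [j|x y]; last first.
  by rewrite coefM; apply: eq_bigr => j _; rewrite mul1r.
have [jm|jm] := boolP ((j <= m) && (i - j <= l))%N; last first.
  apply: biform_ext (Biform0 _ _) _ => x y; rewrite /phi !coef_lin_exp.
  by move: jm; case: (_ <= m)%N; case: (_ <= l)%N; rewrite //= ?mul0r ?mulr0.
case/andP: jm => jm jl.
apply: biform_ext (BiformL ('C(m, j) * 'C(l, i - j))%:R (BiformMono jm jl) (Biform0 _ _)) _.
move=> x y; rewrite /phi !coef_lin_exp jm jl natrM -[_ *+ 'C(m, j)]mulr_natl -[_ *+ 'C(l, _)]mulr_natl; ring.
Qed.

(** Each coefficient of the right-hand side is bihomogeneous of degrees [k + m] and [k + l], hence a
    linear functional of the tensor of powers; these functionals are the rows of [T]. *)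
Lemma transvectant_ex k m l :
  exists T : 'M[C]_((m + l).+1, (k + m).+1 * (k + l).+1), forall x y,
    T *m (veronese (k + m) x *t veronese (k + l) y) =
    det2 x y ^+ k *: coefvec (m + l) (lin x ^+ m * lin y ^+ l).
Proof.
have rowP i := biform_row (biformM (biform_det2X k) (biform_lin m l i)).
have [r rP] := choice rowP.
exists (\matrix_(i, j) r i 0 j) => x y; apply/matrixP => i j.
rewrite !ord1 !mxE -rP mxE; apply: eq_bigr => p _.
by rewrite !mxE.
Qed.

(** Equivariance need only be checked on tensors of powers, where it is the invariance of [det2]
    under matrices of determinant 1. *)
Lemma transvectant_sym k m l :
  exists2 T : 'M[C]_((m + l).+1, (k + m).+1 * (k + l).+1), T != 0 &
    forall g, \det g = 1 ->
      T *m (sym (k + m) g *t sym (k + l) g) = sym (m + l) g *m T.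
Proof.
have [T TP] := transvectant_ex k m l; exists T => [|g g1].
  (* At the two standard basis vectors [det2] is 1 and the form is ['X^l], with coefficient 1 in
     degree [l]. *)
  apply/eqP => T0; have := TP (delta_mx 0 0) (delta_mx 1 0).
  rewrite T0 mul0mx => /colP/(_ (inord l))/eqP.
  rewrite !mxE inordK ?ltnS ?leq_addl // /det2 /lin !mxE /=.
  rewrite !scale0r !scale1r polyC0 polyC1 add0r addr0 !expr1n mul1r coefXn eqxx.
  by rewrite mul1r mulr0 subr0 expr1n mulr1 eq_sym oner_eq0.
have symV n x : sym n g *m veronese n x = veronese n (g *m x).
  by have := @sym_lin n 0 g x x (leq0n n); rewrite subn0 !expr0 !mulr1.
apply: tens_veronese_span => x y.
rewrite -!mulmxA tensmx_mul !symV !TP -scalemxAr det2_mul g1 mul1r.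
have := @sym_lin (m + l) l g x y (leq_addl m l); rewrite addnK => ->.
by [].
Qed.
End SymModel.

(** * The irreducible representations of SU(2) on binary forms *)

Section SU2Family.
Variable R : realType.
Local Notation C := (Cplx R).

Definition su2 := {g : 'M[C]_2 | SU2 g}.

Definition fam d (rho : 'M[C]_2 -> 'M[C]_d) (g : su2) : 'M[C]_d := rho (sval g).

Lemma SU2_1 : SU2 (1%:M : 'M[C]_2).
Proof.
by split; [apply/unitarymxP; rewrite trmx1 map_mx1 mul1mx | rewrite det1].
Qed.

Lemma SU2_mul (g h : 'M[C]_2) : SU2 g -> SU2 h -> SU2 (g *m h).
Proof.
by move=> [gU g1] [hU h1]; split; [exact: mul_unitarymx | rewrite det_mulmx g1 h1 mulr1].
Qed.

Lemma ord2_case (i : 'I_2) : i = 0 \/ i = 1.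
Proof. by case: i => [[|[|//]] ?]; [left | right]; apply/val_inj. Qed.

Lemma SU2_tor (z : C) : `|z| = 1 -> SU2 (tor z).
Proof.
move=> z1; have z0 : z != 0 by rewrite -normr_eq0 z1 oner_eq0.
have zC : z * z^* = 1 by rewrite -normCK z1 expr1n.
have zCV : z^-1 = z^* by apply: (mulfI z0); rewrite zC mulfV.
split; last first.
  by rewrite det_diag !big_ord_recl big_ord0 !mxE /= mulr1 mulfV.
apply/unitarymxP/matrixP => i j; rewrite !mxE !big_ord_recl big_ord0 !mxE /=.
have zVC : (z^-1)^* = z by rewrite zCV conjCK.
by case: (ord2_case i) => ->; case: (ord2_case j) => ->;
  rewrite /= ?mulr0n ?mulr1n ?rmorph0 ?mulr0 ?mul0r ?addr0 ?add0r ?zVC ?zC ?mulVf.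
Qed.

Lemma rep_fam_irr d (rho : su2_rep R d) : rep_irreducible rho -> fam_irr (fam rho).
Proof.
move=> [d0 irr]; split=> // P Plin Pst u Pu u0 v.
have [U UP] := lin_closed_vspace Plin.
have [|U0|UT] := irr U.
- by move=> g w gS /UP Pw; apply/UP; apply: (Pst (exist _ g gS)).
- by move/UP: Pu; rewrite U0 memv0 (negPf u0).
- by apply/UP; rewrite UT memvf.
Qed.

Lemma circle_separates m : (0 < m)%N -> exists2 z : C, `|z| = 1 & z ^+ m != 1.
Proof.
move=> m0; exists (m.-root (-1)).
  by apply/eqP; rewrite -(@pexpr_eq1 _ _ m) -?normrX ?rootCK ?normrN1.
by rewrite rootCK // eq_sym -subr_eq0 opprK -mulr2n pnatr_eq0.
Qed.

(** The torus acts on the monomials with distinct weights, so an invariant subspace contains each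
    monomial occurring in its elements; a rotation without zero entries then links all monomials. *)
Lemma sym_irr n : fam_irr (fam (@sym C n)).
Proof.
split=> // P [P0 PL] Pst.
pose circle := {z : C | `|z| = 1}.
pose wt (j : 'I_n.+1) (z : circle) : 'M[C]_1 := (sval z ^+ (n - j) * (sval z)^-1 ^+ j)%:M.
have wt_irr j : fam_irr (wt j).
  split=> // Q [Q0 QL] _ u Qu u0 v.
  have -> : v = (v 0 0 / u 0 0) *: u + 0.
    have u00 : u 0 0 != 0.
      by apply: contraNneq u0 => u00; apply/eqP/colP => i; rewrite !ord1 u00 mxE.
    by apply/colP => i; rewrite !ord1 addr0 !mxE mulfVK.
  exact: QL.
have wt_noniso i j T : i != j -> intertwines (wt i) (wt j) T -> T = 0.
  have wlog_noniso (a b : 'I_n.+1) : (a < b)%N -> exists z : circle,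
      wt a z 0 0 != wt b z 0 0.
    (* The quotient of the weights [a] and [b] is [z] to the power [2 * (b - a)]. *)
    move=> ab; have [|z z1 zm] := @circle_separates ((b - a) + (b - a)); first lia.
    exists (exist _ z z1); rewrite !mxE /= !mulr1n; apply: contra_neq zm => eqz.
    have z0 : z != 0 by rewrite -normr_eq0 z1 oner_eq0.
    apply: (mulIf (expf_neq0 (n - b) z0)); apply: (mulIf (expf_neq0 b (invr_neq0 z0))).
    rewrite mul1r -{}eqz.
    have bn : (b <= n)%N by rewrite -ltnS.
    rewrite -!exprD [(_ + (b - a) + _)%N](_ : _ = (n - a) + (b - a))%N; last lia.
    rewrite exprD -mulrA; congr (_ * _).
    have {2}-> : (b = (b - a) + a :> nat)%N by lia.
    by rewrite exprD mulrA -exprMn mulfV // expr1n mul1r.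
  move=> ij hT; have [z wz] : exists z, wt i z 0 0 != wt j z 0 0.
    case: (ltngtP i j) => h; first exact: wlog_noniso.
      by have [z hz] := wlog_noniso _ _ h; exists z; rewrite eq_sym.
    by case/eqP: ij; apply/val_inj.
  have /matrixP/(_ 0 0) := hT z; rewrite !mxE !big_ord_recl !big_ord0 !addr0 => /eqP.
  rewrite mulrC -subr_eq0 -mulrBl mulf_eq0 subr_eq0 (negPf wz) /= => /eqP T0.
  by apply/matrixP => a b; rewrite !ord1 T0 mxE.
pose flat (r : 'I_n.+1 -> 'cV[C]_1) : 'cV[C]_n.+1 := \col_i r i 0 0.
have comp v i : P v -> P (v i 0 *: delta_mx i 0).
  move=> Pv.
  have := @invariant_component C circle _ (fun=> 1%N) wt wt_irr wt_noniso (fun r => P (flat r))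
    _ _ _ (fun i => (v i 0)%:M) i.
  have -> : flat (fun i => (v i 0)%:M) = v by apply/colP => j; rewrite !mxE.
  have -> : flat (fun i0 => if i0 == i then (v i0 0)%:M else 0) = v i 0 *: delta_mx i 0.
    apply/colP => j; rewrite !mxE; case: eqVneq => [->|_]; first by rewrite !mxE mulr1.
    by rewrite mxE mulr0.
  apply=> //.
  - suff -> : flat (fun=> 0) = 0 by [].
    by apply/colP => j; rewrite !mxE.
  - move=> c a b Pa Pb; suff -> : flat (fun i => c *: a i + b i) = c *: flat a + flat b by apply: PL.
    by apply/colP => j; rewrite !mxE.
  - move=> z a Pa.
    have -> : flat (fun i => wt i z *m a i) = fam (@sym C n) (exist _ _ (SU2_tor (svalP z))) *m flat a.
      apply/colP => j; rewrite !mxE big_ord1 !mxE (bigD1 j) //= big1 ?addr0 => [|k kj].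
        by rewrite sym_tor !mxE eqxx.
      by rewrite sym_tor eq_sym (negPf kj) mul0r.
    exact: Pst.
have scaleP c v : P v -> P (c *: v) by move=> Pv; rewrite -[_ *: v]addr0; apply: PL.
have basisP v i : P v -> v i 0 != 0 -> P (delta_mx i 0).
  move=> /(comp _ i) Pv vi; have := scaleP (v i 0)^-1 _ Pv.
  by rewrite scalerA mulVf // scale1r.
(* The 3-4-5 triangle gives a rotation with rational nonzero entries. *)
pose g0 : 'M[C]_2 := (5%:R)^-1 *: \matrix_(i, j)
  (if i == 0 then if j == 0 then 3%:R else - 4%:R else if j == 0 then 4%:R else 3%:R).
have g0S : SU2 g0.
  have conj_nat k : (k%:R : C)^* = k%:R by rewrite rmorph_nat.
  split.
    apply/unitarymxP/matrixP => i j; rewrite !mxE !big_ord_recl big_ord0 !mxE /=.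
    by case: (ord2_case i) => ->; case: (ord2_case j) => ->;
      rewrite /= !rmorphM !fmorphV ?rmorphN /= !conj_nat; field.
  rewrite (expand_det_row _ 0) /cofactor !big_ord_recl big_ord0 !det_mx11 !mxE /=.
  by rewrite /bump leqnn !addn0 add0n expr0 expr1; field.
have g0P v : P v -> P (sym n g0 *m v) by apply: (Pst (exist _ g0 g0S)).
have nz k : k.+1%:R != 0 :> C by rewrite pnatr_eq0.
move=> u Pu u0 v.
have [j uj] : exists j, u j 0 != 0.
  apply: contrapT => h; move/eqP: u0; apply; apply/colP => j; rewrite mxE.
  by apply: contrapT => uj; apply: h; exists j; apply/eqP.
(* [g0] carries any monomial to a form with nonzero coefficient 0, and the monomial of index 0 to a
   form with all coefficients nonzero. *)
have Pe0 : P (delta_mx 0 0).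
  apply: (basisP _ _ (g0P _ (basisP _ _ Pu uj))).
  rewrite -colE !mxE coef0M !coef_lin_exp /= !bin0 !subn0 !expr0 !mulr1 !mulr1n.
  rewrite mulf_neq0 ?expf_neq0 // !mxE /= mulf_neq0 ?invr_neq0 ?oppr_eq0 //.
have PeP i : P (delta_mx i 0).
  apply: (basisP _ _ (g0P _ Pe0)).
  rewrite -colE !mxE /= subn0 expr0 mulr1 coef_lin_exp -ltnS ltn_ord.
  rewrite mulrn_eq0 negb_or -lt0n bin_gt0 -ltnS ltn_ord /=.
  by rewrite !mxE /= mulf_neq0 ?expf_neq0 ?mulf_neq0 ?invr_neq0.
rewrite (matrix_sum_delta v); under eq_bigr do rewrite big_ord1.
elim/big_ind: _ => // [w1 w2 h1 h2|i _]; last exact: scaleP.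
by rewrite -[w1]scale1r; apply: PL.
Qed.
End SU2Family.

(** * Continuous characters of the circle *)

Section CircleCharacters.
Variable R : realType.
Local Notation C := (Cplx R).
Local Notation toC r := (Complex r 0 : C).

Definition cis (t : R) : C := Complex (cos t) (sin t).

Lemma cisD s t : cis (s + t) = cis s * cis t.
Proof. by apply/eqP; rewrite eq_complex /= cosD sinD eqxx addrC mulrC eqxx. Qed.

Lemma cis0 : cis 0 = 1.
Proof. by apply/eqP; rewrite eq_complex /= cos0 sin0 !eqxx. Qed.

Lemma normr_cis t : `|cis t| = 1.
Proof. by rewrite normc_def /= cos2Dsin2 sqrtr1. Qed.

Lemma cis_neq0 t : cis t != 0.
Proof. by rewrite -normr_eq0 normr_cis oner_eq0. Qed.

Lemma cisN t : cis (- t) = (cis t)^-1.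
Proof. by apply: (mulfI (cis_neq0 t)); rewrite -cisD subrr cis0 mulfV ?cis_neq0. Qed.

Lemma cisMn t n : cis (t *+ n) = cis t ^+ n.
Proof. by elim: n => [|n IH]; rewrite ?cis0 // mulrS exprS cisD IH. Qed.

Lemma cis2pi : cis (pi *+ 2) = 1.
Proof. by apply/eqP; rewrite eq_complex /= cos2pi sin2pi !eqxx. Qed.

Lemma cis_surj z : `|z| = 1 -> exists t, z = cis t.
Proof.
case: z => a b; rewrite normc_def /= => /eqP; rewrite eq_complex /= => /andP[/eqP ab _].
have {}ab : a ^+ 2 + b ^+ 2 = 1.
  by rewrite -[LHS]sqr_sqrtr ?addr_ge0 ?sqr_ge0 // ab expr1n.
have a1 : -1 <= a <= 1 by apply/andP; have := sqr_ge0 b; split; nra.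
have sa : Num.sqrt (1 - a ^+ 2) = `|b| by rewrite -ab addrC addKr sqrtr_sqr.
have [b0|b0] := leP 0 b; [exists (acos a) | exists (- acos a)];
  rewrite /cis ?cosN ?sinN sin_acos // acosK ?in_itv // sa.
  by rewrite ger0_norm.
by rewrite ltr0_norm // opprK.
Qed.

Lemma normr_lt1_Re_gt0 (w : C) : `|w - 1| < 1 -> 0 < complex.Re w.
Proof.
move=> w1; have := le_lt_trans (normc_ge_Re (w - 1)) w1.
rewrite ltcR; case: w {w1} => a b /=.
by rewrite ltr_norml ltrBrDr addNr => /andP[].
Qed.

(** Square roots in the right half-plane are unique; this fixes the value of a character at half of
    a small angle. *)
Lemma pos_Re_sqr_inj (w w' : C) :
  0 < complex.Re w -> 0 < complex.Re w' -> w ^+ 2 = w' ^+ 2 -> w = w'.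
Proof.
move=> w0 w'0 /eqP; rewrite eqf_sqr => /orP[/eqP //|/eqP e].
move: w0 w'0; rewrite e; case: w' {e} => a b /=.
by rewrite oppr_gt0 => /lt_trans h /h; rewrite ltxx.
Qed.

(** The arcsine of the imaginary part lies in the required interval, and positivity of the real part
    fixes the sign of the cosine. *)
Lemma cis_surj_Re_gt0 z : `|z| = 1 -> 0 < complex.Re z ->
  exists a, [/\ z = cis a, a < pi / 2 & - (pi / 2) < a].
Proof.
case: z => x y; rewrite normc_def /= => /eqP; rewrite eq_complex /= => /andP[/eqP xy _] x0.
have {}xy : x ^+ 2 + y ^+ 2 = 1.
  by rewrite -[LHS]sqr_sqrtr ?addr_ge0 ?sqr_ge0 // xy expr1n.
have [y1 y2] : -1 < y /\ y < 1 by split; nra.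
exists (asin y); split.
- rewrite /cis cos_asin ?(ltW y1) ?(ltW y2) // asinK ?in_itv /= ?(ltW y1) ?(ltW y2) //.
  by rewrite -xy addrK sqrtr_sqr gtr0_norm.
- by rewrite asin_ltpi2 ?(ltW y1).
- by rewrite asin_gtNpi2 ?(ltW y2) ?y1.
Qed.

(** Reduce modulo [pi *+ 2] by a floor: in the remaining interval the sine vanishes only at 0 and
    [pi], and the cosine excludes [pi]. *)
Lemma cis_eq1 t : cis t = 1 -> exists k : int, t = pi *+ 2 *~ k.
Proof.
have pi0 := pi_gt0 R.
move=> t1; pose k := Num.floor (t / (pi *+ 2)); exists k.
pose r := t - pi *+ 2 *~ k.
have r1 : cis r = 1.
  have cisMz (m : int) : cis (pi *+ 2 *~ m) = 1.
    case: m => m; first by rewrite -pmulrn cisMn cis2pi expr1n.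
    by rewrite NegzE mulrNz -pmulrn cisN cisMn cis2pi expr1n invr1.
  by rewrite /r cisD cisN cisMz t1 invr1 mulr1.
have r_ge0 : 0 <= r.
  rewrite subr_ge0 -mulrzl -ler_pdivlMr ?floor_le //; lra.
have r_lt : r < pi *+ 2.
  have := floorD1_gt (t / (pi *+ 2)); rewrite -/k ltr_pdivrMr; last lra.
  by rewrite intrD mulrDl mul1r mulrzl /r ltrBlDl.
suff /eqP : r = 0 by rewrite subr_eq0 => /eqP.
have [cr sr] : cos r = 1 /\ sin r = 0 by case: r1.
apply/eqP; rewrite eq_le r_ge0 andbT leNgt; apply/negP => r0.
have [r_pi|r_pi|r_pi] := ltgtP r pi.
- by have := @sin_gt0_pi _ r; rewrite r0 r_pi sr ltxx => /(_ isT).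
- have : 0 < sin (r - pi).
    by apply: sin_gt0_pi; rewrite subr_gt0 r_pi ltrBlDl -mulr2n.
  have -> : sin (r - pi) = - sin r by rewrite -[in RHS](subrK pi r) sinDpi opprK.
  by rewrite sr oppr0 ltxx.
- by move: cr; rewrite r_pi cospi; lra.
Qed.

(** A continuous homomorphism from the circle to the nonzero complex numbers, written as a function
    of the angle; by multiplicativity, continuity at 0 suffices. *)
Definition circle_char (h : R -> C) : Prop :=
  [/\ forall s t, h (s + t) = h s * h t, h (pi *+ 2) = 1 &
      forall e : R, 0 < e -> exists2 d : R, 0 < d &
        forall t, `|t| < d -> `|h t - 1| < toC e].

Lemma circle_char0 h : circle_char h -> h 0 = 1.
Proof.
by case=> hD h1 _; have := hD 0 (pi *+ 2); rewrite add0r h1 mulr1.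
Qed.

Lemma circle_charMn h t n : circle_char h -> h (t *+ n) = h t ^+ n.
Proof.
move=> hh; have [hD _ _] := hh.
by elim: n => [|n IH]; rewrite ?circle_char0 // mulrS exprS hD IH.
Qed.

Lemma cis_continuous0 (e : R) : 0 < e ->
  exists2 d : R, 0 < d & forall t, `|t| < d -> `|cis t - 1| < toC e.
Proof.
(* The squared distance from [cis t] to 1 is [2 * (1 - cos t)], whence the tolerance
   [e ^+ 2 / 2]. *)
move=> e0; have := @continuous_cos R 0; move/cvgrPdist_lt => /(_ (e ^+ 2 / 2)).
rewrite divr_gt0 ?exprn_gt0 // => /(_ isT)/nbhs_norm0P[d d0 hd].
exists d => // t /hd /=; rewrite cos0 => ht.
rewrite normc_def ltcR /=.
have -> : (cos t - 1) ^+ 2 + (sin t + - 0) ^+ 2 = 2 * (1 - cos t).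
  by rewrite subr0 sin2cos2; ring.
rewrite -(ger0_norm (ltW e0)) -sqrtr_sqr ltr_sqrt ?exprn_gt0 //.
by have := le_lt_trans (ler_norm _) ht; lra.
Qed.

Lemma circle_char_cisMz (m : int) : circle_char (fun t => cis (t *~ m)).
Proof.
split=> [s t||e e0]; first by rewrite mulrzDl cisD.
  case: m => m; first by rewrite -pmulrn cisMn cis2pi expr1n.
  by rewrite NegzE mulrNz -pmulrn cisN cisMn cis2pi expr1n invr1.
have [d d0 hd] := cis_continuous0 e0.
(* Adding 1 keeps the divisor positive when [m] is 0. *)
have m0 : 0 < `|m%:~R| + 1 :> R by rewrite ltr_wpDl.
exists (d / (`|m%:~R| + 1)) => [|t]; first exact: divr_gt0.
rewrite ltr_pdivlMr // => td; apply: hd; rewrite -mulrzr normrM.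
by apply: le_lt_trans td; rewrite ler_wpM2l // lerDl.
Qed.

Lemma circle_charM h g : circle_char h -> circle_char g -> (forall t, `|g t| = 1) ->
  circle_char (fun t => h t * g t).
Proof.
move=> [hD h1 hc] [gD g1 gc] gn; split=> [s t||e e0].
- by rewrite hD gD mulrACA.
- by rewrite h1 g1 mulr1.
have e2 : 0 < e / 2 by rewrite divr_gt0.
have [d1 d10 hd] := hc _ e2; have [d2 d20 gd] := gc _ e2.
exists (Num.min d1 d2) => [|t]; first by rewrite lt_min d10.
rewrite lt_min => /andP[/hd hh /gd hg].
have -> : h t * g t - 1 = (h t - 1) * g t + (g t - 1) by ring.
apply: le_lt_trans (ler_normD _ _) _; rewrite normrM gn mulr1.
have -> : toC e = toC (e / 2) + toC (e / 2).
  by apply/eqP; rewrite eq_complex /= addr0 eqxx andbT -splitr.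
exact: ltrD.
Qed.

Definition dyad n : R := pi *+ 2 / 2 ^+ n.

Lemma dyad_gt0 n : 0 < dyad n.
Proof. by rewrite divr_gt0 ?exprn_gt0 // pmulrn_lgt0 ?pi_gt0. Qed.

Lemma dyadS n : dyad n = dyad n.+1 *+ 2.
Proof. rewrite /dyad exprS; field; by rewrite expf_neq0. Qed.

Lemma dyad_small (e : R) : 0 < e -> exists n0, forall n, (n0 <= n)%N -> dyad n < e.
Proof.
move=> e0; have pi0 := pi_gt0 R.
exists (Num.truncn (pi *+ 2 / e)).+1 => n nn.
rewrite /dyad ltr_pdivrMr ?exprn_gt0 // mulrC -ltr_pdivrMr //.
apply: lt_le_trans (truncnS_gt _) _; rewrite -natrX ler_nat.
by apply: leq_trans nn _; apply/ltnW/ltn_expl.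
Qed.

(** Each [t >= 0] lies within [dyad n] of a multiple of [dyad n], so [h t] is also the value of [h]
    at an arbitrarily small angle. *)
Lemma circle_char_trivial h n0 : circle_char h ->
  (forall n, (n0 <= n)%N -> h (dyad n) = 1) -> forall t, h t = 1.
Proof.
move=> hh hdy; have [hD _ hc] := hh.
have pos t : 0 <= t -> h t = 1.
  move=> t0; apply/eqP/negPn/negP => ht.
  (* With the modulus of [h t - 1] itself as tolerance, continuity makes that number smaller than
     itself. *)
  pose w := h t - 1.
  have eE : toC (complex.Re `|w|) = `|w| by apply: RRe_real; apply: normr_real.
  have e0 : 0 < complex.Re `|w|.
    have : 0 < toC (complex.Re `|w|) by rewrite eE normr_gt0 subr_eq0.
    by rewrite ltcE => /andP[].
  have [d d0 hd] := hc _ e0.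
  have [n1 n1P] := dyad_small d0.
  pose n := maxn n0 n1; have dn : dyad n < d by apply: n1P; rewrite leq_maxr.
  pose m := Num.truncn (t / dyad n).
  have := truncn_itv (divr_ge0 t0 (ltW (dyad_gt0 n))); rewrite -/m.
  rewrite ler_pdivlMr ?dyad_gt0 // ltr_pdivrMr ?dyad_gt0 // !mulr_natl mulrSr => /andP[m1 m2].
  have ht' : h t = h (t - dyad n *+ m).
    by rewrite -{1}(subrK (dyad n *+ m) t) hD circle_charMn // hdy ?leq_maxl // expr1n mulr1.
  have r_lt : `|t - dyad n *+ m| < d.
    by rewrite ger0_norm ?subr_ge0 //; apply: lt_trans dn; rewrite ltrBlDl.
  by have := hd _ r_lt; rewrite -ht' eE ltxx.
move=> t; have [/pos //|/ltW t0] := leP 0 t.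
by have := hD t (- t); rewrite subrr circle_char0 // (pos (- t)) ?oppr_ge0 // mulr1.
Qed.

(** Near 0 the values have positive real part. One small dyadic angle determines [k], and agreement
    with [cis] persists under halving by uniqueness of square roots in the right half-plane. The
    quotient is then trivial at all small dyadic angles, hence everywhere. *)
Lemma circle_char_cis h : circle_char h -> exists k : int, forall t, h t = cis (t *~ k).
Proof.
move=> hh; have [hD h1 hc] := hh; have pi0 := pi_gt0 R.
have [d d0 hd] := hc 1 ltr01; have [n0 n0P] := dyad_small d0.
have Re_h n : (n0 <= n)%N -> 0 < complex.Re (h (dyad n)).
  move=> nn; apply/normr_lt1_Re_gt0/hd.
  by rewrite gtr0_norm ?dyad_gt0 ?n0P.
have hN : h (dyad n0) ^+ (2 ^ n0) = 1.
  rewrite -circle_charMn // -h1; congr h.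
  by rewrite -[LHS]mulr_natr natrX /dyad divfK ?expf_neq0.
have hnorm : `|h (dyad n0)| = 1.
  by apply/eqP; rewrite -(@pexpr_eq1 _ _ (2 ^ n0)) ?expn_gt0 // -normrX hN normr1.
have [a [ha a_lt a_gt]] : exists a, [/\ h (dyad n0) = cis a, a < pi / 2 & - (pi / 2) < a].
  exact: cis_surj_Re_gt0 hnorm (Re_h n0 (leqnn _)).
have [k kP] : exists k : int, a *+ (2 ^ n0) = pi *+ 2 *~ k.
  by apply: cis_eq1; rewrite cisMn -ha.
have {kP} ak : a = dyad n0 *~ k.
  by rewrite /dyad -mulrzAl -kP -[a *+ _]mulr_natr natrX mulfK // expf_neq0.
exists k.
(* The bound on the angle is carried along because, halved, it makes the real part of the next [cis]
   positive. *)
have hk m : h (dyad (n0 + m)) = cis (dyad (n0 + m) *~ k) /\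
    - (pi / 2) < dyad (n0 + m) *~ k < pi / 2.
  elim: m => [|m]; first by rewrite addn0 -ak ha a_lt a_gt.
  rewrite addnS; set n := (n0 + m)%N; case=> IHn /andP[IHl IHr].
  have e2 : dyad n *~ k = dyad n.+1 *~ k *+ 2.
    by rewrite dyadS mulr2n mulrzDl -mulr2n.
  have bnd : - (pi / 2) < dyad n.+1 *~ k < pi / 2.
    by move: IHl IHr; rewrite e2; move: (_ *~ k) => c c1 c2; apply/andP; split; lra.
  split=> //; apply: pos_Re_sqr_inj.
  - by apply: Re_h; rewrite /n -addnS leq_addr.
  - exact: cos_gt0_pihalf.
  - by rewrite -circle_charMn // -dyadS IHn e2 cisMn.
have chu : circle_char (fun t => h t * (cis (t *~ k))^-1).
  apply: circle_charM => //; last by move=> t; rewrite normfV normr_cis invr1.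
  have -> : (fun t => (cis (t *~ k))^-1) = (fun t => cis (t *~ - k)).
    by apply: funext => t; rewrite mulrNz cisN.
  exact: circle_char_cisMz.
move=> t; apply: (divIf (cis_neq0 (t *~ k))); rewrite divff ?cis_neq0 //.
apply: (circle_char_trivial (n0 := n0) chu) => n nn.
by rewrite -(subnKC nn); have [-> _] := hk (n - n0)%N; rewrite divff ?cis_neq0.
Qed.
End CircleCharacters.

(** * Classification of the continuous irreducible representations *)

Section Classification.
Variable R : realType.
Local Notation C := (Cplx R).
Local Notation toC r := (Complex r 0 : C).

Lemma SU2_tor_cis (t : R) : SU2 (tor (cis t)).
Proof. exact/SU2_tor/normr_cis. Qed.

Lemma tor_cisD (s t : R) : tor (cis (s + t)) = tor (cis s) *m tor (cis t).
Proof.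
rewrite mulmx_diag; congr diag_mx; apply/rowP => i; rewrite !mxE cisD.
by case: (i == 0); rewrite // invfM.
Qed.

Lemma rep_continuous_tor d (rho : su2_rep R d) (e : R) :
  rep_continuous rho -> 0 < e ->
  exists2 r : R, 0 < r & forall t, `|t| < r ->
    forall i j, `|rho (tor (cis t)) i j - (i == j)%:R| < toC e.
Proof.
move=> /subspace_continuousP/(_ 1%:M (@SU2_1 R)) rho1 e0.
have eC : 0 < toC e by rewrite ltcE /= eqxx.
have nbh1 : nbhs (1%:M : 'M[C]_2) (fun g => SU2 g -> ball (rho 1%:M) (toC e) (rho g)).
  exact: (rho1 _ (nbhsx_ballx _ _ eC)).
have [r /= r0 hr] := (nbhs_ballP _ _).1 nbh1.
(* Balls in [C] have complex radii; a positive one has zero imaginary part. *)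
case: r r0 hr => r r' r0 hr; have [r'0 {}r0] : r' = 0 /\ 0 < r.
  by move: r0; rewrite ltcE /= => /andP[/eqP].
have [s s0 sP] := cis_continuous0 r0.
exists s => // t ts i j.
have bt : ball (1%:M : 'M[C]_2) (Complex r r') (tor (cis t)).
  split=> [|a b]; first by rewrite r'0 ltcE /= eqxx.
  rewrite -ball_normE /= r'0 !mxE distrC.
  case: (a == b); rewrite ?mulr0n ?mulr1n ?subr0; last by rewrite normr0 ltcE /= eqxx.
  case: (a == 0); first exact: sP.
  by rewrite -cisN; apply: sP; rewrite normrN.
have [_ /(_ i j)] := hr _ bt (SU2_tor_cis t).
by rewrite -ball_normE /= rep_one mxE distrC.
Qed.

(** A finite subfamily whose span has largest dimension spans every [A t]. Triangularity in a fixed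
    basis is a linear condition, so triangularizing that finite list suffices. *)
Lemma cotrigonalize_family (I : eqType) d (A : I -> 'M[C]_d) :
  (forall s t, comm_mx (A s) (A t)) ->
  exists2 P : 'M[C]_d, P \in unitmx & forall t, is_trig_mx (P *m A t *m invmx P).
Proof.
move=> Acomm.
pose Q n := `[< exists ts : seq I, \dim <<[seq A t | t <- ts]>>%VS = n >].
have exQ : exists n, Q n by exists (\dim <<[seq A t | t <- [::]]>>%VS); apply/asboolP; exists [::].
have ubQ n : Q n -> (n <= \dim {: 'M[C]_d})%N.
  by move=> /asboolP[ts <-]; rewrite dimvS ?subvf.
case: (ex_maxnP exQ ubQ) => n /asboolP[ts dts] maxn_.
have span_ts t : A t \in <<[seq A t | t <- ts]>>%VS.
  suff -> : <<[seq A t | t <- ts]>>%VS = <<[seq A t | t <- t :: ts]>>%VS.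
    by apply: memv_span; rewrite mem_head.
  apply/eqP; rewrite eqEdim; apply/andP; split.
    by rewrite /= span_cons addvSr.
  by rewrite dts; apply: maxn_; apply/asboolP; exists (t :: ts).
have [|P Pu /allP Ptrig] := @cotrigonalization C d [seq A t | t <- ts].
  by move=> _ _ /mapP[s _ ->] /mapP[t _ ->].
have Punit := unitarymx_unit Pu; exists P => // t.
move: (span_ts t); set X := [seq _ | _ <- ts] in Ptrig *; move=> /(coord_span (X := in_tuple X)) ->.
rewrite mulmx_sumr mulmx_suml; apply/is_trig_mxP => i j ij.
rewrite summxE big1 // => k _; rewrite -scalemxAr -scalemxAl mxE.
have /Ptrig /= : (in_tuple X)`_k \in X by rewrite mem_nth.
by rewrite /similar_to /= conjumx // => /is_trig_mxP ->; rewrite ?mulr0.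
Qed.

Lemma trig_mul_diag d (A B : 'M[C]_d) i :
  is_trig_mx A -> is_trig_mx B -> (A *m B) i i = A i i * B i i.
Proof.
move=> /is_trig_mxP At /is_trig_mxP Bt; rewrite mxE (bigD1 i) //= big1 ?addr0 // => j ji.
have [ij|ij|ij] := ltngtP i j; first by rewrite At ?mul0r.
  by rewrite Bt ?mulr0.
by case/eqP: ji; apply/val_inj.
Qed.

(** Diagonal entries are multiplicative on triangular matrices, so after conjugation each diagonal
    entry of the torus action is a circle character. *)
Lemma mxtrace_rep_tor d (rho : su2_rep R d) : rep_continuous rho ->
  exists k : 'I_d -> int, forall t : R, \tr (rho (tor (cis t))) = \sum_i cis (t *~ k i).
Proof.
move=> rhoc; pose A t := rho (tor (cis t)).
have AD s t : A (s + t) = A s *m A t by rewrite /A tor_cisD rep_mul //; apply: SU2_tor_cis.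
have [|P Pu Ptrig] := cotrigonalize_family (A := A).
  by move=> s t; exact: etrans (esym (AD s t)) (etrans (congr1 A (addrC s t)) (AD t s)).
pose h i t := (P *m A t *m invmx P) i i.
have hchar i : circle_char (h i).
  split=> [s t||e e0].
  - rewrite /h -trig_mul_diag ?Ptrig // AD; congr (fun_of_matrix _ i i).
    by rewrite !mulmxA mulmxKV.
  - by rewrite /h /A cis2pi tor1 rep_one mulmx1 mulmxV // mxE eqxx.
  (* [M] bounds how conjugation by [P] magnifies entrywise errors; the divisor [m + 1] below is
     positive and keeps the final estimate strict. *)
  pose M := \sum_j \sum_l `|P i j| * `|invmx P l i|.
  have M0 : 0 <= M by do 2!(apply: sumr_ge0 => ? _); apply: mulr_ge0.
  have [m Mm] : exists m : R, M = toC m.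
    by exists (complex.Re M); apply/esym/RRe_real/ger0_real.
  have m0 : 0 < m + 1.
    by move: M0; rewrite Mm lecE /= => /andP[_ h0]; lra.
  have [r r0 rP] := rep_continuous_tor rhoc (divr_gt0 e0 m0).
  exists r => // t /rP ht.
  have -> : h i t - 1 = \sum_j \sum_l P i j * (A t j l - (j == l)%:R) * invmx P l i.
    have -> : h i t - 1 = (P *m (A t - 1%:M) *m invmx P) i i.
      rewrite mulmxBr mulmxBl mulmx1 mulmxV // /h; move: (P *m A t *m invmx P) => X.
      by rewrite !mxE eqxx.
    rewrite mxE exchange_big /=; apply: eq_bigr => l _.
    by rewrite mxE mulr_suml; apply: eq_bigr => j _; rewrite !mxE.
  have le_M : `|\sum_j \sum_l P i j * (A t j l - (j == l)%:R) * invmx P l i| <= M * toC (e / (m + 1)).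
    rewrite (le_trans (ler_norm_sum _ _ _)) // mulr_suml ler_sum // => j _.
    rewrite (le_trans (ler_norm_sum _ _ _)) // mulr_suml ler_sum // => l _.
    by rewrite !normrM mulrAC ler_wpM2l ?mulr_ge0 // ltW.
  apply: le_lt_trans le_M _.
  have -> : M * toC (e / (m + 1)) = toC (m * (e / (m + 1))).
    by rewrite Mm; apply/eqP; rewrite eq_complex /= !mul0r !mulr0 subr0 addr0 !eqxx.
  rewrite ltcE /= eqxx /= mulrA ltr_pdivrMr // mulrC ltr_pM2l //; lra.
have /choice[k kP] := fun i => circle_char_cis (hchar i).
exists k => t; under eq_bigr do rewrite -kP.
by rewrite -/(A t) -[LHS]/(\tr (A t)) -[A t]mul1mx -(mulVmx Pu) -mulmxA mxtrace_mulC.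
Qed.
Local Open Scope sesquilinear_scope.

(** * Conjugation into the maximal torus and Weyl symmetry *)

Lemma SU2_adj (u : 'M[C]_2) : SU2 u -> [/\ SU2 (u ^t*), u *m u ^t* = 1%:M & u ^t* *m u = 1%:M].
Proof.
move=> [uU u1]; have uu := unitarymxP uU.
split; [split; first by rewrite trmxC_unitary | exact: uu | exact: mulmx1C uu].
by rewrite det_map_mx det_tr u1 rmorph1.
Qed.

Lemma mxtrace_rep_conj d (rho : su2_rep R d) (u g : 'M[C]_2) : SU2 u -> SU2 g ->
  \tr (rho (u ^t* *m g *m u)) = \tr (rho g).
Proof.
move=> uS gS; have [uS' uu _] := SU2_adj uS.
have ugS : SU2 (u ^t* *m g) by exact: SU2_mul.
by rewrite !rep_mul // mxtrace_mulC mulmxA -rep_mul // uu rep_one mul1mx.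
Qed.

(** A diagonalizing unitary matrix is corrected to determinant 1 by a diagonal unitary factor;
    diagonal matrices commute, so the diagonal form is unchanged. *)
Lemma SU2_conj_tor (g : 'M[C]_2) : SU2 g ->
  exists t u, SU2 u /\ g = u ^t* *m tor (cis t) *m u.
Proof.
move=> gS; have [_ gg gg'] := SU2_adj gS.
have /orthomx_spectralP : g \is normalmx by apply/normalmxP; rewrite gg gg'.
set P := spectralmx g; set sp := spectral_diag g => gE.
have PU : P \is unitarymx by exact: spectral_unitarymx.
pose dl := \det P.
have dlC : dl * dl^* = 1.
  by rewrite -[X in _ * X^*]det_tr -det_map_mx -det_mulmx (unitarymxP PU) det1.
have dl0 : dl != 0 by apply: contra_eq_neq dlC => ->; rewrite mul0r eq_sym oner_eq0.
pose D : 'M[C]_2 := diag_mx (\row_i if i == 0 then dl^* else 1).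
have DU : D \is unitarymx.
  apply/unitarymxP; rewrite tr_diag_mx map_diag_mx mulmx_diag -diag_const_mx.
  congr diag_mx; apply/rowP => i; rewrite !mxE.
  case: (i == 0); last by rewrite rmorph1 mulr1.
  by rewrite -[RHS]dlC mulrC; congr (_ * _); exact: conjCK.
have uS : SU2 (D *m P).
  split; first exact: mul_unitarymx.
  by rewrite det_mulmx det_diag !big_ord_recl big_ord0 !mxE /= !mulr1 mulrC dlC.
have DD : D ^t* *m D = 1%:M by apply: mulmx1C; apply/unitarymxP.
have gE' : g = (D *m P) ^t* *m diag_mx sp *m (D *m P).
  rewrite {1}gE invmx_unitary // trmx_mul map_mxM -!mulmxA; congr (_ *m _).
  by rewrite [diag_mx sp *m (D *m P)]mulmxA [diag_mx sp *m D]diag_mxC !mulmxA DD mul1mx.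
move: (D *m P) uS gE' => u uS gE'; have [uS' uu' u'u] := SU2_adj uS.
have [spU sp1] : SU2 (diag_mx sp).
  have -> : diag_mx sp = u *m g *m u ^t*.
    by rewrite gE' !mulmxA uu' mul1mx -!mulmxA uu' mulmx1.
  exact: SU2_mul (SU2_mul uS gS) uS'.
have spz : sp 0 0 * sp 0 1 = 1.
  move: sp1; rewrite det_diag !big_ord_recl big_ord0 mulr1.
  by congr (_ * sp 0 _ = _); apply/val_inj.
have zn : `|sp 0 0| = 1.
  move/unitarymxP/matrixP/(_ 0 0): spU.
  rewrite tr_diag_mx map_diag_mx mulmx_diag !mxE eqxx !mulr1n -normCK.
  by move/eqP; rewrite sqrp_eq1 // => /eqP.
have [t zt] := cis_surj zn; exists t, u; split; first exact: uS.
rewrite gE'; congr (_ *m _ *m _); congr diag_mx; apply/rowP => i; rewrite mxE -zt.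
case: (ord2_case i) => -> //=.
have z0 : sp 0 0 != 0 by rewrite -normr_eq0 zn oner_eq0.
by apply: (mulfI z0); rewrite spz mulfV.
Qed.

(** Conjugation by the Weyl element [w] exchanges the two diagonal entries. *)
Lemma mxtrace_rep_torV d (rho : su2_rep R d) (z : C) : `|z| = 1 ->
  \tr (rho (tor z^-1)) = \tr (rho (tor z)).
Proof.
move=> z1; pose w : 'M[C]_2 := \matrix_(i, j) (if i == j then 0 else if i == 0 then 1 else -1).
have wS : SU2 w.
  split.
    apply/unitarymxP/matrixP => i j; rewrite !mxE !big_ord_recl big_ord0 !mxE /=.
    by case: (ord2_case i) => ->; case: (ord2_case j) => ->;
      rewrite /= ?rmorphN ?rmorph0 ?rmorph1 ?mulr0 ?mul0r ?mulr1 ?mulrNN ?addr0 ?add0r ?mulr1.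
  rewrite (expand_det_row _ 0) /cofactor !big_ord_recl big_ord0 !det_mx11 !mxE /=.
  by rewrite /bump leqnn !addn0 add0n expr0 expr1 mul0r add0r addr0 mul1r mulrNN mulr1.
rewrite -[RHS](mxtrace_rep_conj _ wS); last exact: SU2_tor.
congr (\tr (rho _)); apply/matrixP => i j; rewrite !mxE !big_ord_recl big_ord0 !mxE.
rewrite !big_ord_recl !big_ord0 !mxE /= invrK.
by case: (ord2_case i) => ->; case: (ord2_case j) => ->;
  rewrite /= ?rmorphN ?rmorph0 ?rmorph1 ?mulr0n ?mulr1n; ring.
Qed.

(** * Characters of binary forms and the classification *)

Definition sym_rep n : su2_rep R n.+1 :=
  Su2Rep (@sym1 C n) (fun g h _ _ => sym_mul n g h).

Local Notation chi n z := (\tr (@sym C n (tor z))).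

Lemma chiSS n (z : C) : z != 0 -> chi n.+2 z = z ^+ n.+2 + z^-1 ^+ n.+2 + chi n z.
Proof.
move=> z0; rewrite mxtrace_sym_tor big_ord_recl big_ord_recr /= subn0 expr0 mulr1.
rewrite (eq_bigr (fun j : 'I_n.+1 => z ^+ (n - j) * z^-1 ^+ j)) => [|j _].
  by rewrite -mxtrace_sym_tor /bump leq0n add1n subnn expr0 mul1r (addrC _ (_ ^+ _)) addrA.
have -> : (n.+2 - lift ord0 (widen_ord (leqnSn n.+1) j) = (n - j).+1)%N.
  by rewrite /= /bump leq0n; have := ltn_ord j; lia.
by rewrite /= /bump leq0n add1n !exprS mulrACA mulfV // mul1r.
Qed.

(** For [m] at least 2 the sum is the character of degree [m] minus that of degree [m - 2]; it is
    the character of degree 1 for [m = 1], and twice that of degree 0 for [m = 0]. *)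
Lemma power_sum_chi N m : (m < N)%N -> exists c : 'I_N -> C,
  forall z, z != 0 -> z ^+ m + z^-1 ^+ m = \sum_n c n * chi n z.
Proof.
have pick_term k (F : nat -> C) : (k < N)%N -> \sum_(n < N) (n == k :> nat)%:R * F n = F k.
  move=> kN; rewrite (bigD1 (Ordinal kN)) //= eqxx mul1r big1 ?addr0 // => n.
  by rewrite -val_eqE /= => /negPf ->; rewrite mul0r.
case: m => [|[|m]] mN.
- exists (fun n => 2 * (n == 0%N :> nat)%:R) => z z0.
  under eq_bigr do rewrite -mulrA.
  rewrite -mulr_sumr (pick_term 0%N (fun n => chi n z)) // mxtrace_sym_tor big_ord1 /=.
  by rewrite !expr0 !mulr1.
- exists (fun n => (n == 1%N :> nat)%:R) => z z0.
  rewrite (pick_term 1%N (fun n => chi n z)) // mxtrace_sym_tor !big_ord_recl big_ord0 /=.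
  by rewrite subn0 /bump leqnn subnn !expr0 !expr1 mulr1 mul1r addr0.
- exists (fun n => (n == m.+2 :> nat)%:R - (n == m :> nat)%:R) => z z0.
  under eq_bigr do rewrite mulrBl.
  rewrite sumrB (pick_term m.+2 (fun n => chi n z)) // (pick_term m (fun n => chi n z)); last lia.
  by rewrite chiSS // addrK.
Qed.

Lemma fam_noniso (G : Type) d d' (f : G -> 'M[C]_d) (f' : G -> 'M[C]_d') T :
  fam_irr f -> fam_irr f' -> d != d' -> intertwines f f' T -> T = 0.
Proof.
move=> irrf irrf' dd fT; apply/eqP/negPn/negP => T0.
have [S TS ST] := schur_iso irrf irrf' fT T0; move/negP: dd; apply.
by rewrite eqn_leq (mulmx1_min TS) (mulmx1_min ST).
Qed.

(** Otherwise [rho] and the [sym n] with [n < N] would be irreducible without intertwiners between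
    them, and [trace_independent] would refute a relation whose coefficient at [rho] is 2. *)
Lemma irr_rep_sym d (rho : su2_rep R d) : rep_continuous rho -> rep_irreducible rho ->
  exists n (T : 'M[C]_(n.+1, d)), intertwines (fam rho) (fam (@sym C n)) T /\ T != 0.
Proof.
move=> rhoc rhoi; apply: contrapT => nosym.
have noT n T : intertwines (fam rho) (fam (@sym C n)) T -> T = 0.
  move=> hT; apply/eqP/negPn/negP => T0; apply: nosym; by exists n, T.
have [k kP] := mxtrace_rep_tor rhoc.
pose N := (\max_i `|k i|%N).+1.
have kN i : (`|k i|%N < N)%N by rewrite ltnS (leq_bigmax i).
have [c cP] := choice (fun i => power_sum_chi (kN i)).
(* The trace is the same at [t] and [- t], so doubling it symmetrizes the exponents. *)
have sumT (t : R) : 2 * \tr (rho (tor (cis t))) = \sum_n (\sum_i c i n) * chi n (cis t).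
  have -> : 2 * \tr (rho (tor (cis t))) = \sum_i (cis (t *~ k i) + cis (- (t *~ k i))).
    rewrite big_split /= -kP mulr2n mulrDl mul1r; congr (_ + _).
    rewrite -[LHS]mxtrace_rep_torV ?normr_cis // -cisN kP.
    by apply: eq_bigr => i _; rewrite mulNrz.
  under [RHS]eq_bigr do rewrite mulr_suml.
  rewrite exchange_big /=; apply: eq_bigr => i _; rewrite -cP ?cis_neq0 // -cisN -!cisMn.
  case: (k i) => m; first by rewrite -pmulrn mulNrn.
  by rewrite NegzE abszN mulrNz opprK -pmulrn mulNrn addrC.
pose D (o : option 'I_N) := if o is Some n then n.+1 else d.
pose f : forall o, su2 R -> 'M[C]_(D o) :=
  fun o => match o with Some n => fam (@sym C n) | None => fam rho end.
pose e : su2 R := exist _ 1%:M (@SU2_1 R).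
pose op (g h : su2 R) : su2 R := exist _ _ (SU2_mul (svalP g) (svalP h)).
pose cc (o : option 'I_N) : C := if o is Some n then - (\sum_i c i n) else 2.
have irrf o : fam_irr (f o) by case: o => [n|]; [exact: sym_irr | exact: rep_fam_irr].
have := @trace_independent C (su2 R) _ D f e op cc irrf _ _ _ _ None.
move=> h; have : (2 : C) = 0; last by move/eqP; rewrite pnatr_eq0.
apply: h => [i j T ij hT|o|o g h|g].
- case: i j T ij hT => [n|] [m|] //= T ij hT.
  + by apply: fam_noniso hT; [exact: sym_irr | exact: sym_irr |].
  + apply/eqP/negPn/negP => T0.
    have [S TS ST] := schur_iso (sym_irr R n) (rep_fam_irr rhoi) hT T0.
    have S0 : S = 0.
      apply: noT => g; rewrite -[LHS]mulmx1 -TS mulmxA -(mulmxA S) -hT.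
      by rewrite mulmxA ST mul1mx.
    by move: ST; rewrite S0 mul0mx => /matrixP/(_ 0 0)/eqP; rewrite !mxE eq_sym oner_eq0.
  + exact: noT hT.
- by case: o => [n|]; rewrite /f /fam /= ?sym1 ?rep_one.
- by case: o => [n|]; rewrite /f /fam /= ?sym_mul ?rep_mul //; apply: svalP.
- rewrite (bigD1 None) //= (reindex_omap Some id) /= => [|[]//].
  under eq_bigl do rewrite eqxx.
  (* The relation on the torus extends to the whole group, every element being conjugate into the
     torus. *)
  have [t [u [uS gE]]] := SU2_conj_tor (svalP g).
  rewrite /fam gE mxtrace_rep_conj ?sumT //; last exact: SU2_tor_cis.
  rewrite -big_split big1 //= => n _.
  rewrite (mxtrace_rep_conj (sym_rep n) uS (SU2_tor_cis t)) /=; ring.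
Qed.
End Classification.

(** * The Clebsch-Gordan decomposition *)

Section ClebschGordan.
Variable R : realType.
Local Notation C := (Cplx R).

Lemma irr_rep_iso_sym n (rho : su2_rep R n.+1) :
  rep_continuous rho -> rep_irreducible rho ->
  exists T S : 'M[C]_n.+1,
    [/\ T *m S = 1%:M, S *m T = 1%:M, intertwines (fam rho) (fam (@sym C n)) T &
        intertwines (fam (@sym C n)) (fam rho) S].
Proof.
move=> rhoc rhoi; have [m [T [hT T0]]] := irr_rep_sym rhoc rhoi.
have nm : n = m.
  apply/eqP/negPn/negP => nm; move/eqP: T0; apply.
  apply: fam_noniso hT; [exact: rep_fam_irr | exact: sym_irr |].
  by rewrite eqSS.
case: m / nm T hT T0 => T hT T0.
have [S TS ST] := schur_iso (rep_fam_irr rhoi) (sym_irr R n) hT T0.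
exists T, S; split=> // g.
by rewrite -[LHS]mulmx1 -TS mulmxA -(mulmxA S) -hT mulmxA ST mul1mx.
Qed.

(** [k] is the order of the transvectant, transported from [sym] along [irr_rep_iso_sym]. Dimensions
    enter as equations because those of the given representations are known only propositionally. *)
Lemma clebsch_gordan_projection k m l d1 d2 d3
    (V1 : su2_rep R d1) (V2 : su2_rep R d2) (V3 : su2_rep R d3) :
  d1 = (k + m).+1 -> d2 = (k + l).+1 -> d3 = (m + l).+1 ->
  rep_continuous V1 -> rep_irreducible V1 -> rep_continuous V2 -> rep_irreducible V2 ->
  rep_continuous V3 -> rep_irreducible V3 ->
  exists T, intertwines (fam (tens_rep V1 V2)) (fam V3) T /\ T != 0.
Proof.
move=> e1 e2 e3; case: _ / (esym e1) V1 => V1; case: _ / (esym e2) V2 => V2.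
case: _ / (esym e3) V3 => V3 c1 i1 c2 i2 c3 i3.
have [T1 [S1 [TS1 ST1 hT1 _]]] := irr_rep_iso_sym c1 i1.
have [T2 [S2 [TS2 ST2 hT2 _]]] := irr_rep_iso_sym c2 i2.
have [T3 [S3 [TS3 ST3 _ hS3]]] := irr_rep_iso_sym c3 i3.
have [T T0 TP] := transvectant_sym C k m l.
exists (S3 *m T *m (T1 *t T2)); split=> [g|].
  have [_ g1] := svalP g.
  rewrite /fam /= -!mulmxA tensmx_mul [T1 *m _]hT1 [T2 *m _]hT2 -tensmx_mul /fam.
  rewrite (mulmxA T) TP // -mulmxA mulmxA.
  by have := hS3 g; rewrite /fam => ->; rewrite -!mulmxA.
(* [T] is recovered from the composite by inverting the isomorphisms. *)
apply: contraNneq T0 => H.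
have tens1 a b : (1%:M : 'M[C]_a) *t (1%:M : 'M[C]_b) = 1%:M.
  apply/matrixP => i j; case: (mxtens_indexP i) => i1' i2'; case: (mxtens_indexP j) => j1 j2.
  rewrite tensmxE !mxE -natrM mulnb; congr ((nat_of_bool _)%:R).
  by rewrite (can_eq (@mxtens_indexK a b)).
rewrite -[T]mul1mx -TS3 -[T3 *m S3 *m T]mulmx1 -tens1 -TS1 -TS2 -tensmx_mul.
by rewrite -!mulmxA (mulmxA S3) (mulmxA _ (T1 *t T2)) H mul0mx mulmx0.
Qed.

Lemma surj_mx_iso m n (T : 'M[C]_(m, n)) : m = n ->
  (forall w : 'cV_m, exists v : 'cV_n, T *m v = w) ->
  exists S, T *m S = 1%:M /\ S *m T = 1%:M.
Proof.
move=> mn; case: n / mn T => T /choice[phi phiP].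
pose S := \matrix_(i, j) phi (delta_mx j 0) i 0.
have TS : T *m S = 1%:M.
  apply/matrixP => i j; have /colP/(_ i) := phiP (delta_mx j 0).
  rewrite !mxE andbT => <-; apply: eq_bigr => l _.
  by rewrite mxE.
by exists S; split=> //; apply: mulmx1C.
Qed.

(** The image of the joint map is invariant, and distinct dimensions exclude intertwiners between
    the summands. It therefore contains the components of its elements, hence every summand by
    irreducibility; the joint map is onto, and bijective by dimension. *)
Lemma dsum_iso_of_projections (d0 N : nat) (M : su2_rep R d0) (d : 'I_N -> nat)
    (V : forall k, su2_rep R (d k)) (T : forall k, 'M[C]_(d k, d0)) :
  (forall k, rep_irreducible (V k)) -> injective d -> d0 = \sum_k d k ->
  (forall k, intertwines (fam M) (fam (V k)) (T k)) -> (forall k, T k != 0) ->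
  rep_iso M (dsum_rep V).
Proof.
move=> Virr dinj d0E hT T0.
pose im (r : forall k, 'cV[C]_(d k)) := exists v, r = fun k => T k *m v.
have irrV k := rep_fam_irr (Virr k).
have imL c a b : im a -> im b -> im (fun k => c *: a k + b k).
  move=> [u ->] [v ->]; exists (c *: u + v); apply: functional_extensionality_dep => k.
  by rewrite mulmxDr -scalemxAr.
have im0 : im (fun=> 0) by exists 0; apply: functional_extensionality_dep => k; rewrite mulmx0.
have imV g a : im a -> im (fun k => fam (V k) g *m a k).
  move=> [v ->]; exists (fam M g *m v); apply: functional_extensionality_dep => k.
  by rewrite !mulmxA hT.
have noniso i j (F : 'M[C]_(d j, d i)) : i != j -> intertwines (fam (V i)) (fam (V j)) F -> F = 0.
  by move=> ij; apply: fam_noniso => //; apply: contra_neq ij => /dinj.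
(* [b] transported along [k = j], and zero in the other summands. *)
pose single k (b : 'cV[C]_(d k)) j : 'cV[C]_(d j) :=
  if k =P j is ReflectT e then eq_rect k (fun j => 'cV[C]_(d j)) b j e else 0.
have singleE k b : single k b k = b.
  by rewrite /single; case: eqP => // e; rewrite (eq_irrelevance e erefl).
have single0 k b j : k != j -> single k b j = 0.
  by rewrite /single; case: eqP.
have im_single k b : im (single k b).
  have [v Tv0] : exists v : 'cV_d0, T k *m v != 0.
    apply: contrapT => h; move/eqP: (T0 k); apply; apply: eq_mulmx_cV => v.
    by rewrite mul0mx; apply: contrapT => Tv; apply: h; exists v; apply/eqP.
  apply: ((irrV k).2 (fun b => im (single k b)) _ _ (T k *m v)) => //.
  - split=> [|c u w hu hw].
      suff -> : single k 0 = fun=> 0 by [].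
      apply: functional_extensionality_dep => j.
      by have [<-|kj] := eqVneq k j; rewrite ?singleE ?single0.
    suff -> : single k (c *: u + w) = fun j => c *: single k u j + single k w j by apply: imL.
    apply: functional_extensionality_dep => j.
    by have [<-|kj] := eqVneq k j; rewrite ?singleE ?single0 // scaler0 addr0.
  - move=> g u hu.
    suff -> : single k (fam (V k) g *m u) = fun j => fam (V j) g *m single k u j by apply: imV.
    apply: functional_extensionality_dep => j.
    by have [<-|kj] := eqVneq k j; rewrite ?singleE ?single0 // mulmx0.
  - have := invariant_component irrV noniso im0 imL imV k (ex_intro _ v erefl).
    congr im; apply: functional_extensionality_dep => j.
    by have [->|kj] := eqVneq j k; rewrite ?singleE ?single0 // eq_sym.
have im_all r : im r.
  have im_seq (s : seq 'I_N) : uniq s -> im (fun j => if j \in s then r j else 0).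
    elim: s => [|k s IH] /=; first by move=> _; exact: im0.
    case/andP=> ks /IH ims; have := imL 1 _ _ (im_single k (r k)) ims.
    congr im; apply: functional_extensionality_dep => j; rewrite inE.
    have [->|kj] := eqVneq j k; first by rewrite singleE scale1r (negPf ks) addr0.
    by rewrite single0 1?eq_sym // scaler0 add0r.
  have := im_seq (enum 'I_N) (enum_uniq _); congr im.
  by apply: functional_extensionality_dep => j; rewrite mem_enum.
pose TT : 'M[C]_(\sum_k d k, d0) := \mxcol_k T k.
have [||S [TS ST]] := @surj_mx_iso _ _ TT.
- by [].
- move=> w; have [v wv] := im_all (fun k => submxcol w k).
  exists v; rewrite -[RHS]submxcolK mxcol_mul; apply: eq_mxcol => k.
  by have := congr1 (fun r => r k) wv.
exists TT, S; split=> // g gS.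
rewrite /= mul_mxdiag_mxcol mxcol_mul; apply: eq_mxcol => k.
exact: (hT k (exist _ g gS)).
Qed.
End ClebschGordan.

Lemma sum_arith_odd N m : (\sum_(k < N) (m + k.*2).+1 = N * (m + N))%N.
Proof. by elim: N => [|N IH]; rewrite ?big_ord0 // big_ord_recr /= IH; lia. Qed.

Theorem theorem3p2 (R : realType) (s1 s2 : rat)
    (hs1 : half_integer s1) (hs2 : half_integer s2)
    (d1 d2 : nat) (V1 : su2_rep R d1) (V2 : su2_rep R d2)
    (hV1 : is_spin_rep s1 V1) (hV2 : is_spin_rep s2 V2)
    (N : nat) (hN : N%:R = (s1 + s2) - `|s1 - s2| + 1 :> rat)
    (d : 'I_N -> nat) (V : forall k : 'I_N, su2_rep R (d k))
    (hV : forall k : 'I_N, is_spin_rep (`|s1 - s2| + (k : nat)%:R) (V k)) :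
  rep_iso (tens_rep V1 V2) (dsum_rep V).
Proof.
case: hs1 hs2 hV1 hV2 => a s1E [b s2E] [d1E c1 i1] [d2E c2 i2].
(* With [a] and [b] the doubled spins, [gap] is twice the lowest spin on the right, and there are
   [lo + 1] summands. *)
pose lo := minn a b; pose gap := (maxn a b - lo)%N.
have gapE : `|s1 - s2| = gap%:R / 2 :> rat.
  rewrite s1E s2E -mulrBl normrM [`|2^-1|]ger0_norm ?invr_ge0 //; congr (_ / _).
  rewrite /gap /lo; case: (leqP a b) => ab.
    by rewrite ler0_norm ?subr_le0 ?ler_nat // opprB natrB.
  by rewrite ger0_norm ?subr_ge0 ?ler_nat 1?ltnW // natrB // ltnW.
have loE : (a + b = gap + lo + lo)%N by rewrite /gap /lo; lia.
have {d1E} d1E : d1 = a.+1.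
  by apply/eqP; rewrite -(eqr_nat rat) d1E s1E -[eqbRHS]natr1; apply/eqP; field.
have {d2E} d2E : d2 = b.+1.
  by apply/eqP; rewrite -(eqr_nat rat) d2E s2E -[eqbRHS]natr1; apply/eqP; field.
have {hN} NE : N = lo.+1.
  have loQ : a%:R + b%:R = gap%:R + lo%:R + lo%:R :> rat by rewrite -!natrD loE.
  apply/eqP; rewrite -(eqr_nat rat) hN gapE s1E s2E -[eqbRHS]natr1; apply/eqP.
  lra.
have dE k : d k = (gap + k.*2).+1.
  have [dk _ _] := hV k; apply/eqP; rewrite -(eqr_nat rat) dk gapE -[eqbRHS]natr1 natrD -mul2n natrM.
  by apply/eqP; field.
have proj k : exists T, intertwines (fam (tens_rep V1 V2)) (fam (V k)) T /\ T != 0.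
  have [_ ck ik] := hV k; have kN := leq_trans (ltn_ord k) (eq_leq NE).
  have [k_a k_b] : (lo - k <= a)%N /\ (lo - k <= b)%N by rewrite /lo; lia.
  (* The [k]-th summand has degree [gap + 2 k = a + b - 2 (lo - k)], so it is the target of the
     transvectant of order [lo - k]. *)
  apply: (@clebsch_gordan_projection R (lo - k) (a - (lo - k)) (b - (lo - k))) => //.
  - by rewrite subnKC.
  - by rewrite subnKC.
  - by rewrite dE; congr _.+1; lia.
have [T TP] : exists T : (forall k, 'M[Cplx R]_(d k, d1 * d2)), forall k,
    intertwines (fam (tens_rep V1 V2)) (fam (V k)) (T k) /\ T k != 0.
  by exists (fun k => projT1 (cid (proj k))) => k; case: cid.
apply: (dsum_iso_of_projections (T := T)) => [k|i j|||].
- by have [] := hV k.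
- by rewrite !dE => -[/eqP]; rewrite eqn_add2l => /eqP/double_inj/val_inj.
(* Both dimensions equal [(lo + 1) * (gap + lo + 1)], whose factors are [a + 1] and [b + 1] in some
   order. *)
- rewrite (eq_bigr (fun k : 'I_N => (gap + k.*2).+1)) // sum_arith_odd d1E d2E NE.
  by rewrite /gap /lo; case: (leqP a b); nia.
- by move=> k; have [] := TP k.
- by move=> k; have [] := TP k.
Qed.
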